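(* Let $n\ge 2$ be an integer. If every stable lattice $x\in\mathcal{L}_n$ satisfies $\mathrm{covrad}(x)\le\frac{\sqrt n}{2}$, then Minkowski's conjecture is true in dimension $n$, that is, every $x\in\mathcal{L}_n$ satisfies $$\sup_{u\in\mathbb{R}^n}\ \inf_{v\in x}|N(u-v)|\le\frac{1}{2^n}.$$
   Context: $\mathcal{L}_n=\mathrm{SL}_n(\mathbb{R})/\mathrm{SL}_n(\mathbb{Z})$ is the space of unimodular (covolume one) lattices in $\mathbb{R}^n$. A lattice $x\in\mathcal{L}_n$ is stable if every nonzero subgroup $\Lambda\subset x$ has covolume at least $1$ in $\mathrm{span}(\Lambda)$. The covering radius is $\mathrm{covrad}(x)=\max_{u\in\mathbb{R}^n}\min_{v\in x}\|u-v\|$, with $\|\cdot\|$ the Euclidean norm. For $u=(u_1,\dots,u_n)\in\mathbb{R}^n$, $N(u)=\prod_{j=1}^n u_j$. *)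

(* Defs.v *)
From mathcomp Require Import all_boot all_order all_algebra.
From mathcomp Require Import all_classical all_reals ereal.

Set Implicit Arguments.
Unset Strict Implicit.
Unset Printing Implicit Defensive.

Import Order.TTheory GRing.Theory Num.Theory.

Local Open Scope classical_set_scope.
Local Open Scope ring_scope.

(* B Z^k: the integer combinations of the columns of B. *)
Definition Zspan (R : realType) (n k : nat) (B : 'M[R]_(n, k)) : set 'cV[R]_n :=
  range (fun z : 'cV[int]_k => B *m map_mx intr z).

(* The coset g SL_n(Z) is identified with the lattice g Z^n. *)
Definition unimodular_lattice (R : realType) (n : nat) : set (set 'cV[R]_n) :=
  [set Zspan g | g in [set g : 'M[R]_n | \det g = 1]].

(* The norm that the library puts on matrices is the sup norm. *)
Definition enorm (R : realType) (n : nat) (u : 'cV[R]_n) : R :=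
  Num.sqrt (\sum_(j < n) u j 0 ^+ 2).

(* The covolume of L in span(L): if the columns of B are an R-linearly
   independent Z-basis of L, the k-dimensional volume of the parallelepiped
   they span is the square root of their Gram determinant. It does not depend
   on the basis (see covolE). The default value 0 is only taken on sets that
   are not discrete subgroups, hence on no subgroup of a lattice. *)
Definition covol (R : realType) (n : nat) (L : set 'cV[R]_n) : R :=
  xget 0 [set c | exists (k : nat) (B : 'M[R]_(n, k)),
    [/\ \rank B = k, L = Zspan B & c = Num.sqrt (\det (B^T *m B))]].

Definition stable (R : realType) (n : nat) (x : set 'cV[R]_n) : Prop :=
  forall L : set 'cV[R]_n,
    zmod_closed (mem L) -> L `<=` x -> L <> [set 0] -> 1 <= covol L.

(* For a lattice x the maximum and the minimum in the definition of the
   covering radius are attained, so they are this supremum and infimum; taking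
   these in \bar R avoids default values. *)
Definition covrad (R : realType) (n : nat) (x : set 'cV[R]_n) : \bar R :=
  ereal_sup (range (fun u : 'cV[R]_n =>
    ereal_inf [set (enorm (u - v))%:E | v in x])).

Definition prodN (R : realType) (n : nat) (u : 'cV[R]_n) : R :=
  \prod_(j < n) u j 0.

Definition minkowski_conjecture (R : realType) (n : nat) : Prop :=
  forall x : set 'cV[R]_n, unimodular_lattice x ->
    (ereal_sup (range (fun u : 'cV[R]_n =>
       ereal_inf [set `|prodN (u - v)|%:E | v in x])) <= (1 / 2 ^+ n)%:E)%E.

Lemma Zspan_sub (R : realType) (n k l : nat) (B : 'M[R]_(n, k))
    (C : 'M[R]_(n, l)) : Zspan C `<=` Zspan B ->
  exists P : 'M[int]_(k, l), C = B *m map_mx intr P.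
Proof.
move=> CB.
have /choice[f Hf] : forall j : 'I_l, exists z : 'cV[int]_k,
    col j C = B *m map_mx intr z.
  move=> j; have [|z _ Hz] := CB (col j C); last by exists z.
  exists (delta_mx j 0) => //.
  by rewrite map_delta_mx colE.
exists (\matrix_(i, j) f j i 0); apply/matrixP => i j.
have /matrixP/(_ i 0) := Hf j; rewrite !mxE => ->.
by apply: eq_bigr => m _; rewrite !mxE.
Qed.

Lemma covolE (R : realType) (n k : nat) (B : 'M[R]_(n, k)) :
  \rank B = k -> covol (Zspan B) = Num.sqrt (\det (B^T *m B)).
Proof.
have inj (m p : nat) (D : 'M[R]_(n, m)) (X Y : 'M[R]_(m, p)) :
    \rank D = m -> D *m X = D *m Y -> X = Y.
  move=> rD; have fD : row_free D^T by rewrite /row_free mxrank_tr rD.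
  move=> /(congr1 trmx); rewrite !trmx_mul => /(row_free_inj fD) /(congr1 trmx).
  by rewrite !trmxK.
move=> rB; apply: xget_unique; first by exists k, B.
move=> _ [l [C [rC BC ->]]].
have [P CE] : exists P : 'M[int]_(k, l), C = B *m map_mx intr P.
  by apply: Zspan_sub; rewrite BC.
have [Q BE] : exists Q : 'M[int]_(l, k), B = C *m map_mx intr Q.
  by apply: Zspan_sub; rewrite BC.
have PQ : P *m Q = 1%:M.
  suff /matrixP E : map_mx intr (P *m Q) = 1%:M :> 'M[R]_k.
    apply/matrixP => i j; have := E i j.
    by rewrite !mxE -[X in _ = X]mulrz_nat natz => /intr_inj.
  by rewrite map_mxM; apply: (inj _ _ B) => //; rewrite mulmxA -CE -BE mulmx1.
have kl : k = l.
  apply/eqP; rewrite eqn_leq -{1}rB -{2}rC {1}BE {2}CE.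
  by rewrite !(leq_trans (mxrankM_maxl _ _)) ?rC ?rB.
move: C rC BC P CE Q BE PQ; case: _ / kl => C _ _ P -> Q _ PQ; congr Num.sqrt.
have Pu : \det P \is a GRing.unit by have [] := mulmx1_unit PQ.
have P2 : \det P * \det P = 1 by move: Pu => /pred2P[] ->.
rewrite trmx_mul mulmxA -(mulmxA _ B^T) !det_mulmx det_tr !det_map_mx.
by rewrite mulrC mulrA -rmorphM /= P2 mul1r.
Qed.

(* Main.v *)
Require Import Defs.
From mathcomp Require Import all_boot all_order all_algebra all_fingroup.
From mathcomp Require Import all_classical all_reals ereal.
From mathcomp Require Import topology normedtype sequences exp.
From mathcomp Require Import ring lra zify.

(* Write Z for the integer matrices whose columns are a basis of a subgroup. For a > 0 diagonal of
   determinant one, N(a u) = N(u), so by the arithmetic-geometric mean inequality it is enough that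
   some stable lattice h Z^n is a limit of lattices a g Z^n with a diagonal.

   To find it, maximize over the closure of the orbit the function
   m(h) = min_Z Phi(h, Z), Phi(h, Z) = covol(h Z)^2 exp(eps k (n - k)), with k the rank of Z. The
   maximum is attained because the lattices with m(h) >= m > 0 have bases bounded in terms of m.
   Suppose m(h) < 1 at a maximum h. Since covol is submodular and k (n - k) strictly concave, the minimizing subgroups
   form a chain; let P_i be the orthogonal projections onto their spans, together with P = 1. By
   convexity, covol(exp(x) h Z)^2 >= covol(h Z)^2 exp(2 <x, diag P_i>), strictly unless diag(x)
   commutes with P_i.
   - If x is orthogonal to all diag P_i and does not commute with some P_i, then moving h along x
     keeps it a maximum and removes a minimizing subgroup.
   - If every x orthogonal to all diag P_i commutes with all P_i, then a dimension count for
     commuting diagonalizable matrices shows that the diag P_i are linearly independent, so some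
     direction x of trace zero increases all minimal covolumes at once.
   Hence the number of minimizing ranks can be decreased forever, which is absurd. So m = 1 for all
   eps > 0, and eps -> 0 yields a stable lattice in the orbit closure. *)

Set Implicit Arguments.
Unset Strict Implicit.
Unset Printing Implicit Defensive.

Import Order.TTheory GRing.Theory Num.Theory.
Import numFieldNormedType.Exports.

Local Open Scope classical_set_scope.
Local Open Scope ring_scope.

(** * Gram determinants and the Cauchy-Binet formula *)

(** The sum runs over all maps rather than over subsets: non-injective maps contribute zero and each
    subset is counted once per ordering. Expanding the first determinant over permutations, each
    permutation contributes one copy of [\det (A *m B)]. *)
Lemma cauchy_binet (R : comNzRingType) (k n : nat) (A : 'M[R]_(k, n)) (B : 'M[R]_(n, k)) :
  \sum_(f : {ffun 'I_k -> 'I_n}) \det (colsub f A) * \det (rowsub f B)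
    = \det (A *m B) *+ k`!.
Proof.
have detE : \det (A *m B) =
    \sum_(f : {ffun 'I_k -> 'I_n}) (\prod_i A i (f i)) * \det (rowsub f B).
  rewrite /determinant (eq_bigr (fun f : {ffun 'I_k -> 'I_n} => \sum_(s : 'S_k)
    (-1) ^+ s * \prod_i (A i (f i) * B (f i) (s i)))); last first.
    move=> f _; rewrite big_distrr; apply: eq_bigr => s _ /=.
    rewrite mulrCA big_split /=; congr (_ * (_ * _)).
    by apply: eq_bigr => i _; rewrite mxE.
  rewrite exchange_big; apply: eq_bigr => s _ /=; rewrite -big_distrr /=.
  congr (_ * _); rewrite -(bigA_distr_bigA (fun i j => A i j * B j (s i))) /=.
  by apply: eq_bigr => i _; rewrite mxE.
transitivity (\sum_(s : 'S_k) \det (A *m B)); last first.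
  by rewrite sumr_const card_Sn.
under eq_bigr => f _.
  rewrite {1}/determinant big_distrl /=; over.
rewrite exchange_big /=; apply: eq_bigr => s _; rewrite detE.
rewrite (reindex (fun f : {ffun 'I_k -> 'I_n} => [ffun i => f ((s^-1)%g i)])) /=; last first.
  exists (fun f : {ffun 'I_k -> 'I_n} => [ffun i => f (s i)]) => f _;
    by apply/ffunP => i; rewrite !ffunE ?permK ?permKV.
apply: eq_bigr => f _.
have -> : rowsub [ffun i => f ((s^-1)%g i)] B = row_perm (s^-1)%g (rowsub f B).
  by apply/matrixP => i j; rewrite !mxE ffunE.
rewrite row_permE det_mulmx det_perm odd_permV mulrCA mulrA mulrA -expr2 sqrr_sign mul1r.
congr (_ * _); apply: eq_bigr => i _.
by rewrite mxE ffunE permK.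
Qed.

Definition gram (R : comNzRingType) (n k : nat) (B : 'M[R]_(n, k)) : R := \det (B^T *m B).

Lemma gram_sum (R : comNzRingType) (n k : nat) (B : 'M[R]_(n, k)) :
  gram B *+ k`! = \sum_(f : {ffun 'I_k -> 'I_n}) \det (rowsub f B) ^+ 2.
Proof.
rewrite /gram -cauchy_binet; apply: eq_bigr => f _.
by rewrite (_ : colsub f B^T = (rowsub f B)^T) ?det_tr //; apply/matrixP => i j; rewrite !mxE.
Qed.

Lemma gramE (R : realFieldType) (n k : nat) (B : 'M[R]_(n, k)) :
  gram B = (k`!%:R)^-1 * \sum_(f : {ffun 'I_k -> 'I_n}) \det (rowsub f B) ^+ 2.
Proof.
by rewrite -gram_sum -[in RHS](mulr_natl (gram B)) mulKf // pnatr_eq0 -lt0n fact_gt0.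
Qed.

Lemma gram_ge0 (R : realFieldType) (n k : nat) (B : 'M[R]_(n, k)) : 0 <= gram B.
Proof.
rewrite gramE mulr_ge0 ?invr_ge0 ?ler0n // sumr_ge0 // => f _; exact: sqr_ge0.
Qed.

Lemma cauchy_binet_field (R : realFieldType) (k n : nat) (A : 'M[R]_(k, n)) (B : 'M[R]_(n, k)) :
  \det (A *m B) =
   (k`!%:R)^-1 * \sum_(f : {ffun 'I_k -> 'I_n}) \det (colsub f A) * \det (rowsub f B).
Proof.
by rewrite cauchy_binet -[in RHS](mulr_natl (\det _)) mulKf // pnatr_eq0 -lt0n fact_gt0.
Qed.

Lemma trmul_eq0 (R : realDomainType) (n : nat) (x : 'cV[R]_n) : x^T *m x = 0 -> x = 0.
Proof.
move=> /matrixP/(_ 0 0); rewrite !mxE => /eqP.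
rewrite psumr_eq0 => [/allP x0|i _]; last by rewrite mxE -expr2 sqr_ge0.
apply/colP => i; have := x0 i (mem_index_enum _).
by rewrite /= !mxE -expr2 sqrf_eq0 => /eqP.
Qed.

(** A nonzero Gram determinant serves throughout as the notion of independent columns, since it
    makes sense over [int] as well as over a field. *)
Lemma gram_kerP (R : realDomainType) (n k : nat) (B : 'M[R]_(n, k)) :
  gram B != 0 <-> forall x : 'cV_k, B *m x = 0 -> x = 0.
Proof.
split=> [Bn0 x Bx|Binj].
  apply: contraNeq Bn0 => xn0; apply/det0P; exists x^T; first by rewrite trmx_eq0.
  by rewrite mulmxA -trmx_mul Bx trmx0 mul0mx.
apply/negP => /det0P[v vn0 vBB]; move: vn0; rewrite -trmx_eq0 (Binj v^T) ?eqxx //.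
apply: trmul_eq0; rewrite trmx_mul trmxK -mulmxA (mulmxA B^T).
by apply: trmx_inj; rewrite mulmxA vBB mul0mx.
Qed.

Lemma gram_gt0 (R : realFieldType) (n k : nat) (B : 'M[R]_(n, k)) :
  (0 < gram B) = (gram B != 0).
Proof. by rewrite lt_def gram_ge0 andbT. Qed.

Lemma gram_mulmx (R : comNzRingType) (n k : nat) (B : 'M[R]_(n, k)) (U : 'M_k) :
  gram (B *m U) = \det U ^+ 2 * gram B.
Proof.
by rewrite /gram trmx_mul mulmxA -(mulmxA _ B^T) !det_mulmx det_tr mulrC mulrA.
Qed.

(** * Orthogonal projections and submodularity *)

Definition proj (R : comUnitRingType) (n k : nat) (B : 'M[R]_(n, k)) : 'M[R]_n :=
  B *m invmx (B^T *m B) *m B^T.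

Section Proj.
Variables (R : realFieldType) (n : nat).

Lemma tr_proj (k : nat) (B : 'M[R]_(n, k)) : (proj B)^T = proj B.
Proof. by rewrite /proj !trmx_mul trmxK trmx_inv trmx_mul trmxK mulmxA. Qed.

Lemma proj_mulK (k : nat) (B : 'M[R]_(n, k)) : gram B != 0 -> proj B *m B = B.
Proof. by move=> B0; rewrite /proj -!mulmxA mulVmx ?mulmx1 // unitmxE unitfE. Qed.

Lemma proj_idem (k : nat) (B : 'M[R]_(n, k)) :
  gram B != 0 -> proj B *m proj B = proj B.
Proof. by move=> B0; rewrite {2 3}/proj !mulmxA proj_mulK. Qed.

Lemma mxtrace_proj (k : nat) (B : 'M[R]_(n, k)) :
  gram B != 0 -> \tr (proj B) = k%:R.
Proof.
by move=> B0; rewrite mxtrace_mulC mulmxA mulmxV ?mxtrace1 // unitmxE unitfE.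
Qed.

Lemma proj_subl (k l : nat) (B : 'M[R]_(n, k)) (C : 'M[R]_(n, l)) (X : 'M_(k, l)) :
  gram B != 0 -> C = B *m X -> proj B *m proj C = proj C.
Proof. by move=> B0 CX; rewrite {2 3}/proj !mulmxA {1}CX mulmxA proj_mulK // -CX. Qed.

Lemma proj_subr (k l : nat) (B : 'M[R]_(n, k)) (C : 'M[R]_(n, l)) (X : 'M_(k, l)) :
  gram B != 0 -> C = B *m X -> proj C *m proj B = proj C.
Proof.
by move=> B0 CX; apply: trmx_inj; rewrite trmx_mul !tr_proj (proj_subl B0 CX).
Qed.

Lemma tr_1B (P : 'M[R]_n) : P^T = P -> (1%:M - P)^T = 1%:M - P.
Proof. by move=> Ps; rewrite linearB /= Ps trmx1. Qed.

Lemma idem_1B (P : 'M[R]_n) : P *m P = P -> (1%:M - P) *m (1%:M - P) = 1%:M - P.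
Proof. by move=> Pi; rewrite mulmxBl mul1mx mulmxBr mulmx1 Pi subrr subr0. Qed.

(** Base times height: the Schur complement of the Gram matrix of [B] is the Gram matrix of the
    component of [C] orthogonal to [B]. *)
Lemma gram_row_mx (k l : nat) (B : 'M[R]_(n, k)) (C : 'M[R]_(n, l)) :
  gram B != 0 -> gram (row_mx B C) = gram B * gram ((1%:M - proj B) *m C).
Proof.
move=> B0; set G := B^T *m B; have Gu : G \in unitmx by rewrite unitmxE unitfE.
rewrite /gram tr_row_mx mul_col_row -/G.
rewrite trmx_mul mulmxA -(mulmxA C^T) tr_1B ?tr_proj // idem_1B ?proj_idem //.
rewrite mulmxBr mulmx1 mulmxBl.
have -> : block_mx G (B^T *m C) (C^T *m B) (C^T *m C) =
   block_mx G 0 (C^T *m B) (C^T *m C - C^T *m proj B *m C)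
    *m block_mx 1%:M (invmx G *m (B^T *m C)) 0 1%:M.
  rewrite mulmx_block !mulmx1 !mulmx0 !addr0; congr block_mx.
    by rewrite mulmxA mulmxV // mul1mx.
  by rewrite /proj -/G !mulmxA addrC subrK.
by rewrite det_mulmx det_lblock det_ublock !det1 !mulr1.
Qed.

(** Stacking the two orthogonal components of [C] preserves its Gram matrix, and the minors of the
    upper block are among the minors of the stack. *)
Lemma gram_projC_le (l : nat) (P : 'M[R]_n) (C : 'M[R]_(n, l)) :
  P^T = P -> P *m P = P -> gram ((1%:M - P) *m C) <= gram C.
Proof.
move=> Ps Pid.
have -> : gram C = gram (col_mx ((1%:M - P) *m C) (P *m C)).
  rewrite /gram tr_col_mx mul_row_col !trmx_mul tr_1B // Ps.
  rewrite !mulmxA -(mulmxA C^T (_ - _)) -(mulmxA C^T P) idem_1B // Pid.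
  by rewrite -mulmxDl -mulmxDr subrK mulmx1.
rewrite !gramE ler_wpM2l ?invr_ge0 ?ler0n //.
set A := _ *m C; set D := _ *m C.
pose phi (f : {ffun 'I_l -> 'I_n}) : {ffun 'I_l -> 'I_(n + n)} := [ffun i => lshift n (f i)].
have phi_inj : injective phi.
  by move=> f g /ffunP fg; apply/ffunP => i; have := fg i; rewrite !ffunE => /lshift_inj.
rewrite [leRHS](bigID (fun f => f \in phi @: setT)) /=.
rewrite -[leLHS]addr0 lerD ?sumr_ge0 // => [|i _]; last exact: sqr_ge0.
rewrite big_imset /=; last by move=> ? ? _ _; apply: phi_inj.
rewrite [leRHS](eq_bigl xpredT) => [|f]; last by rewrite in_setT.
rewrite le_eqVlt; apply/orP; left; apply/eqP; apply: eq_bigr => f _; congr (\det _ ^+ 2).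
by apply/matrixP => i j; rewrite [LHS]mxE [RHS]mxE ffunE col_mxEu.
Qed.

(** In terms of base times height, the height of [Z] over [row_mx I Y] is at most its height over
    [I], because projecting further shrinks volumes. *)
Lemma gram_submod (a b c : nat) (I : 'M[R]_(n, a)) (Y : 'M[R]_(n, b)) (Z : 'M[R]_(n, c)) :
  gram (row_mx I Y) != 0 -> gram I != 0 ->
  gram (row_mx (row_mx I Y) Z) * gram I <= gram (row_mx I Y) * gram (row_mx I Z).
Proof.
move=> IY0 I0; rewrite gram_row_mx // (gram_row_mx Z) // -mulrA ler_wpM2l ?gram_ge0 //.
rewrite mulrC ler_wpM2l ?gram_ge0 //.
set P := proj _; set Q := proj _.
have PQ : P *m Q = Q.
  have E : I = row_mx I Y *m col_mx 1%:M 0 by rewrite mul_row_col mulmx1 mulmx0 addr0.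
  exact: proj_subl IY0 E.
have -> : (1%:M - P) *m Z = (1%:M - P) *m ((1%:M - Q) *m Z).
  by rewrite mulmxA; congr (_ *m _); rewrite mulmxBr mulmx1 mulmxBl mul1mx PQ subrr subr0.
by apply: gram_projC_le; rewrite ?tr_proj ?proj_idem.
Qed.

Lemma gram_row_mxl (a b : nat) (I : 'M[R]_(n, a)) (Y : 'M[R]_(n, b)) :
  gram (row_mx I Y) != 0 -> gram I != 0.
Proof.
move=> /gram_kerP H; apply/gram_kerP => x Ix.
have := H (col_mx x 0); rewrite mul_row_col Ix mulmx0 addr0 => /(_ erefl) /(congr1 usubmx).
by rewrite col_mxKu linear0.
Qed.

End Proj.

(** * The covolume along a diagonal flow *)

Lemma det_replace_row1 (R : comNzRingType) (k : nat) (A : 'M[R]_k) (j : 'I_k) :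
  (forall i l, i != j -> A i l = (i == l)%:R) -> \det A = A j j.
Proof.
move=> A1; have adj1 : \adj (1%:M : 'M[R]_k) = 1%:M.
  by rewrite -[LHS]mul1mx mul_mx_adj det1.
have cofA l : cofactor A j l = (l == j)%:R.
  have /matrixP/(_ l j) := adj1; rewrite !mxE => <-.
  rewrite /cofactor; congr (_ * \det _); apply/matrixP => a b.
  by rewrite !mxE A1 // eq_sym neq_lift.
rewrite (expand_det_row A j) (bigD1 j) //= big1 => [|l /negbTE lj].
  by rewrite cofA eqxx mulr1 addr0.
by rewrite cofA lj mulr0.
Qed.

(** Two block triangular factorizations of the same bordered matrix are compared. *)
Lemma det_rank1D (R : comUnitRingType) (k : nat) (G : 'M[R]_k) (u : 'cV_k) (v : 'rV_k) :
  G \in unitmx -> \det (G + u *m v) = \det G * (1 + (v *m invmx G *m u) 0 0).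
Proof.
move=> Gu.
have E1 : block_mx 1%:M (- v) u G =
    block_mx 1%:M 0 u (G + u *m v) *m block_mx 1%:M (- v) 0 1%:M.
  by rewrite mulmx_block !mulmx1 !mulmx0 !mul1mx !addr0 mulmxN addrC addrK.
have E2 : block_mx 1%:M (- v) u G =
    block_mx 1%:M (- (v *m invmx G)) 0 1%:M *m block_mx (1%:M + v *m invmx G *m u) 0 u G.
  rewrite mulmx_block !mul1mx !mul0mx !add0r mulNmx addrK mulNmx.
  by rewrite -mulmxA mulVmx // mulmx1.
have := congr1 determinant E1; rewrite {1}E2 !det_mulmx !det_lblock !det_ublock !det1 !mul1r mulr1.
by move=> <-; rewrite det_mx11 mulrC; congr (_ * _); rewrite !mxE eqxx mulr1n.
Qed.

Section Jensen.
Variables (R : realType) (n k : nat).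
Implicit Types (B : 'M[R]_(n, k)) (x : 'rV[R]_n) (f : {ffun 'I_k -> 'I_n}).

Definition expmx x : 'M[R]_n := diag_mx (map_mx expR x).

(** For [P = proj B] with independent columns, this is half the logarithmic derivative of
    [gram (expmx (t *: x) *m B)] at [t = 0]. *)
Definition tdiag x (P : 'M[R]_n) := \sum_p x 0 p * P p p.

Lemma rowsub_diag (d : 'rV[R]_n) B f :
  \det (rowsub f (diag_mx d *m B)) = (\prod_i d 0 (f i)) * \det (rowsub f B).
Proof.
have -> : rowsub f (diag_mx d *m B) = diag_mx (\row_i d 0 (f i)) *m rowsub f B.
  by rewrite !mul_diag_mx; apply/matrixP => i j; rewrite !mxE.
by rewrite det_mulmx det_diag; congr (_ * _); apply: eq_bigr => i _; rewrite mxE.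
Qed.

(* By Cauchy-Binet these are the weights of a probability measure, and [gram (expmx x *m B)] is
   [gram B] times the mean of [expR (2 * \sum_i x 0 (f i))]. *)
Definition plucker_wt B f := \det (rowsub f B) ^+ 2 / (k`!%:R * gram B).

Lemma fact_neq0 : k`!%:R != 0 :> R.
Proof. by rewrite pnatr_eq0 -lt0n fact_gt0. Qed.

Lemma plucker_wt_ge0 B f : 0 <= plucker_wt B f.
Proof. by rewrite divr_ge0 ?sqr_ge0 // mulr_ge0 ?gram_ge0 ?ler0n. Qed.

Lemma plucker_wt_sum B : gram B != 0 -> \sum_f plucker_wt B f = 1.
Proof.
move=> B0; rewrite -mulr_suml -gram_sum -[X in X / _]mulr_natl mulfV //.
by rewrite mulf_neq0 // fact_neq0.
Qed.

Lemma gram_diag (d : 'rV[R]_n) B : gram B != 0 ->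
  gram (diag_mx d *m B) = gram B * \sum_f plucker_wt B f * (\prod_i d 0 (f i)) ^+ 2.
Proof.
move=> B0; rewrite gramE !mulr_sumr; apply: eq_bigr => f _.
by rewrite rowsub_diag /plucker_wt; field; rewrite B0 fact_neq0.
Qed.

(** The determinant of [B^T *m B] with row [p] of the right factor doubled is computed in two ways:
    by the rank-one update formula, and by Cauchy-Binet, where the terms whose map hits [p] are
    doubled. *)
Lemma plucker_wt_diag B p : gram B != 0 ->
  \sum_f plucker_wt B f * (\sum_i (f i == p)%:R) = proj B p p.
Proof.
move=> B0.
pose b := row p B.
have E : B^T *m (diag_mx (\row_q (1 + (q == p)%:R)) *m B) = B^T *m B + b^T *m b.
  have -> : diag_mx (\row_q (1 + (q == p)%:R)) = 1%:M + delta_mx p p :> 'M[R]_n.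
    apply/matrixP => i j; rewrite !mxE; case: (i =P j) => [<-|ij].
      by rewrite andbb !mulr1n.
    rewrite mulr0n add0r; case: (i =P p) => //= ip; case: (j =P p) => // jp.
    by case: ij; rewrite ip jp.
  rewrite mulmxDl mul1mx mulmxDr; congr (_ + _).
  have -> : delta_mx p p = delta_mx p 0 *m delta_mx (0 : 'I_1) p :> 'M[R]_n by rewrite mul_delta_mx.
  rewrite -mulmxA -rowE mulmxA; congr (_ *m _).
  by rewrite /b rowE trmx_mul trmx_delta.
have := cauchy_binet_field B^T (diag_mx (\row_q (1 + (q == p)%:R)) *m B).
rewrite E det_rank1D ?unitmxE ?unitfE // -/(gram B) => /(canRL (mulKf B0)).
have -> : b *m invmx (B^T *m B) *m b^T = (proj B p p)%:M.
  rewrite [LHS]mx11_scalar; congr (_%:M).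
  by rewrite /b -row_mul /proj !mxE; apply: eq_bigr => j _; rewrite !mxE.
rewrite mxE eqxx mulr1n => /(canRL (addKr 1)) ->.
rewrite -[in - 1](plucker_wt_sum B0) !mulr_sumr -sumrN -big_split /=; apply: eq_bigr => f _.
rewrite rowsub_diag (_ : colsub f B^T = (rowsub f B)^T); last first.
  by apply/matrixP => i j; rewrite !mxE.
rewrite det_tr /plucker_wt.
have [fi|] := boolP (injectiveb f); last first.
  move=> /injectivePn[i [j ij fij]].
  rewrite (determinant_alternate ij) ?expr0n ?mulr0 ?mul0r ?subrr //.
    by rewrite oppr0 add0r.
  by move=> l; rewrite !mxE fij.
have -> : \prod_i (\row_q (1 + (q == p)%:R)) 0 (f i) = 1 + \sum_i (f i == p)%:R :> R.
  have [/codomP[j pj]|pf] := boolP (p \in codom f).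
    rewrite (bigD1 j) //= big1 => [|i ij]; last first.
      by rewrite mxE pj (inj_eq (injectiveP _ fi)) (negbTE ij) addr0.
    rewrite (bigD1 j) //= big1 => [|i ij].
      by rewrite mxE pj eqxx addr0 mulr1.
    by rewrite pj (inj_eq (injectiveP _ fi)) (negbTE ij).
  rewrite !big1 ?addr0 // => i _; first by case: eqP => // fp; rewrite -fp codom_f in pf.
  by rewrite mxE; case: eqP => [fp|]; rewrite ?addr0 //; rewrite -fp codom_f in pf.
by set d := \det _; set s := \sum_i _; field; rewrite B0 fact_neq0.
Qed.

Lemma plucker_wt_tdiag B x : gram B != 0 ->
  \sum_f plucker_wt B f * (\sum_i x 0 (f i)) = tdiag x (proj B).
Proof.
move=> B0; rewrite /tdiag.
under [RHS]eq_bigr => p _ do rewrite -plucker_wt_diag // mulr_sumr.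
rewrite exchange_big /=; apply: eq_bigr => f _.
under [RHS]eq_bigr => p _ do rewrite mulrCA.
rewrite -mulr_sumr; congr (_ * _).
under [RHS]eq_bigr => p _ do rewrite mulr_sumr.
rewrite exchange_big /=; apply: eq_bigr => i _.
rewrite (bigD1 (f i)) //= eqxx mulr1 big1 ?addr0 // => p /negbTE.
by rewrite eq_sym => ->; rewrite mulr0.
Qed.

Lemma gram_exp B x : gram B != 0 ->
  gram (expmx x *m B) = gram B * \sum_f plucker_wt B f * expR (2 * \sum_i x 0 (f i)).
Proof.
move=> B0; rewrite gram_diag //; congr (_ * _); apply: eq_bigr => f _.
congr (_ * _); rewrite expRM_natl expR_sum; congr (_ ^+ 2).
by apply: eq_bigr => i _; rewrite mxE.
Qed.

(** The mean of [\sum_i x 0 (f i)] is [tdiag x (proj B)], so subtracting the tangent line of the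
    exponential at the mean changes nothing on average. The Jensen defect becomes a sum of
    nonnegative terms. *)
Lemma gram_exp_sub B x : gram B != 0 ->
  gram (expmx x *m B) - gram B * expR (2 * tdiag x (proj B)) =
  gram B * expR (2 * tdiag x (proj B)) * \sum_f plucker_wt B f *
   (expR (2 * (\sum_i x 0 (f i) - tdiag x (proj B)))
     - (1 + 2 * (\sum_i x 0 (f i) - tdiag x (proj B)))).
Proof.
move=> B0; rewrite gram_exp // -mulrBr -mulrA; congr (_ * _).
set l := tdiag _ _; transitivity (\sum_f plucker_wt B f * (expR (2 * \sum_i x 0 (f i))
   - expR (2 * l) * (1 + 2 * (\sum_i x 0 (f i) - l)))).
  have {1}-> : expR (2 * l) = expR (2 * l) * \sum_f plucker_wt B f by rewrite plucker_wt_sum // mulr1.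
  under [RHS]eq_bigr => f _ do rewrite mulrBr; rewrite sumrB; congr (_ - _).
  under [RHS]eq_bigr => f _ do rewrite mulrCA mulrDr mulr1; rewrite -mulr_sumr; congr (_ * _).
  rewrite big_split /= [X in _ + X](_ : _ = 0) ?addr0 //.
  under eq_bigr => f _ do rewrite mulrCA mulrBr; rewrite -mulr_sumr sumrB plucker_wt_tdiag //.
  by rewrite -mulr_suml plucker_wt_sum // mul1r subrr mulr0.
rewrite [RHS]mulr_sumr; apply: eq_bigr => f _; rewrite [RHS]mulrCA; congr (_ * _).
by rewrite [RHS]mulrBr -expRD; congr (expR _ - _); ring.
Qed.

Lemma gram_exp_ge B x : gram B != 0 ->
  gram B * expR (2 * tdiag x (proj B)) <= gram (expmx x *m B).
Proof.
move=> B0; rewrite -subr_ge0 gram_exp_sub // mulr_ge0 ?mulr_ge0 ?gram_ge0 ?expR_ge0 //.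
by rewrite sumr_ge0 // => f _; rewrite mulr_ge0 ?plucker_wt_ge0 // subr_ge0 expR_ge1Dx.
Qed.

(* The Pluecker relations in a chart: if [rowsub f0 C = 1], then [C q j] is itself the Pluecker
   coordinate of [C] at [f0] with [f0 j] replaced by [q]. *)
Lemma weight_const_comm B x (c : R) : gram B != 0 ->
  (forall f, \det (rowsub f B) != 0 -> \sum_i x 0 (f i) = c) ->
  comm_mx (diag_mx x) (proj B).
Proof.
move=> B0 xc.
have [f0 f0n0] : exists f, \det (rowsub f B) != 0.
  apply/existsP; apply: contraNT B0; rewrite negb_exists => /forallP F.
  by rewrite gramE big1 ?mulr0 // => f _; have := F f; rewrite negbK => /eqP ->; rewrite expr0n.
pose F := rowsub f0 B; have Fu : F \in unitmx by rewrite unitmxE unitfE.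
pose C := B *m invmx F; have BC : B = C *m F by rewrite mulmxKV.
have C0 : gram C != 0.
  by move: B0; rewrite BC gram_mulmx mulf_eq0 negb_or => /andP[].
have -> : proj B = proj C.
  by rewrite -[RHS](proj_subl B0 (erefl C)) -{1}(proj_subr C0 BC).
have Cf0 : rowsub f0 C = 1%:M by rewrite /C -mul_rowsub_mx mulmxV.
pose la := \row_j x 0 (f0 j).
(* The columns of [C] are eigenvectors: where [C q j] is nonzero, exchanging [f0 j] for [q] leaves
   the sum of [x] equal to [c], so [x] agrees at [q] and [f0 j]. *)
have xC : diag_mx x *m C = C *m diag_mx la.
  apply/matrixP => q j; rewrite mul_diag_mx mul_mx_diag [LHS]mxE [RHS]mxE [la _ _]mxE mulrC.
  have [->|Cqj] := eqVneq (C q j) 0; first by rewrite !mul0r.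
  congr (_ * _); pose f1 : {ffun _ -> _} := [ffun i => if i == j then q else f0 i].
  have df1 : \det (rowsub f1 C) = C q j.
    rewrite (det_replace_row1 (j := j)) => [|i l ij]; first by rewrite mxE ffunE eqxx.
    by rewrite mxE ffunE (negbTE ij); have /matrixP/(_ i l) := Cf0; rewrite !mxE.
  have := xc f1; rewrite BC -mul_rowsub_mx det_mulmx df1 mulf_neq0 //.
  rewrite -(xc f0) // => /(_ erefl).
  rewrite (bigD1 j) //= [in RHS](bigD1 j) //= ffunE eqxx [X in _ + X](_ : _ = \sum_(i | i != j) x 0 (f0 i)).
    by move=> /addIr.
  by apply: eq_bigr => i ij; rewrite ffunE (negbTE ij).
clearbody C; set G := C^T *m C; have Gu : G \in unitmx by rewrite unitmxE unitfE.
have xCt : C^T *m diag_mx x = diag_mx la *m C^T.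
  by apply: trmx_inj; rewrite !trmx_mul !tr_diag_mx trmxK xC.
have laG : diag_mx la *m G = G *m diag_mx la.
  by rewrite /G mulmxA -xCt -!mulmxA xC.
have laGi : diag_mx la *m invmx G = invmx G *m diag_mx la.
  move: (G) Gu laG => {}G Gu laG.
  by rewrite -[LHS]mul1mx -(mulVmx Gu) -mulmxA (mulmxA G) -laG -!mulmxA mulmxV // mulmx1.
by rewrite /comm_mx /proj -/G !mulmxA xC -!mulmxA xCt (mulmxA (diag_mx la)) laGi !mulmxA.
Qed.

(** Equality makes every term of the Jensen defect vanish, so all maps of positive weight have the
    same sum and [weight_const_comm] applies. *)
Lemma gram_exp_gt B x : gram B != 0 -> ~ comm_mx (diag_mx x) (proj B) ->
  gram B * expR (2 * tdiag x (proj B)) < gram (expmx x *m B).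
Proof.
move=> B0 ncomm; rewrite lt_neqAle gram_exp_ge // andbT; apply/eqP => E; apply: ncomm.
have := gram_exp_sub x B0; rewrite -E subrr => /esym/eqP.
rewrite mulf_eq0 gt_eqF ?mulr_gt0 ?expR_gt0 ?gram_gt0 //= psumr_eq0; last first.
  by move=> f _; rewrite mulr_ge0 ?plucker_wt_ge0 // subr_ge0 expR_ge1Dx.
move=> /allP xf; apply: (@weight_const_comm _ _ (tdiag x (proj B)) B0) => f df.
have := xf f (mem_index_enum _); rewrite mulf_eq0 gt_eqF /=; last first.
  by rewrite divr_gt0 ?exprn_even_gt0 //= mulr_gt0 ?gram_gt0 // ltr0n fact_gt0.
rewrite subr_eq0; apply: contraTeq => xl; rewrite gt_eqF // expR_gt1Dx //.
by rewrite mulf_neq0 ?subr_eq0 ?pnatr_eq0.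
Qed.

Lemma gram_exp_lb B x (t : R) : gram B != 0 -> (forall p, - t <= x 0 p) ->
  gram B * expR (- (2 * k%:R * t)) <= gram (expmx x *m B).
Proof.
move=> B0 xt; rewrite gram_exp // ler_wpM2l ?gram_ge0 //.
set e := expR _; have -> : e = \sum_f plucker_wt B f * e by rewrite -mulr_suml plucker_wt_sum // mul1r.
rewrite ler_sum // => f _.
rewrite ler_wpM2l ?plucker_wt_ge0 // ler_expR -mulrA -mulrN ler_wpM2l //.
rewrite mulr_natl -mulNrn -[X in _ *+ X]card_ord -sumr_const ler_sum //.
Qed.

End Jensen.

(** * Diagonals of commuting projections *)

Lemma idem_diagonalizable (F : fieldType) (n : nat) (P : 'M[F]_n) :
  P *m P = P -> exists2 Q : 'M_n, Q \in unitmx & mxpoly.diagonalizable_for Q P.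
Proof.
move=> PP; apply/mxpoly.diagonalizablePeigen; exists [:: 0; 1].
  by rewrite /= inE eq_sym oner_eq0.
rewrite !big_cons big_nil /=; apply/eqmxP; rewrite submx1 /=.
have {1}-> : 1%:M = (1%:M - P) + P by rewrite subrK.
apply: addmx_sub_adds.
  by apply/eigenspaceP; rewrite scale0r mulmxBl mul1mx PP subrr.
by rewrite addsmx0; apply/eigenspaceP; rewrite scale1r.
Qed.

(** A common eigenbasis turns the matrices into diagonal ones, and these form a space of dimension
    [n]. *)
Lemma codiag_dependent (F : fieldType) (n N : nat) (M : 'I_N -> 'M[F]_n) :
  (n < N)%N -> (forall i j, comm_mx (M i) (M j)) ->
  (forall i, exists2 Q : 'M_n, Q \in unitmx & mxpoly.diagonalizable_for Q (M i)) ->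
  exists2 u : 'rV_N, u != 0 & \sum_i u 0 i *: M i = 0.
Proof.
move=> nN Mc Md.
have [Q Qu /allP/= Qd] : exists2 Q : 'M_n, Q \in unitmx &
    all [pred A | mxpoly.diagonalizable_for Q A] [seq M i | i <- enum 'I_N].
  apply/mxpoly.codiagonalizableP; split.
    by move=> _ _ /mapP[i _ ->] /mapP[j _ ->].
  by move=> _ /mapP[i _ ->].
pose X := \matrix_(i < N, p < n) (Q *m M i *m invmx Q) p p.
have : ~~ row_free X.
  by apply/negP => /eqP rX; have := rank_leq_col X; rewrite rX leqNgt nN.
rewrite -kermx_eq0 -nz_row_eq0 => un0; exists (nz_row (kermx X)) => //.
set u := nz_row _; have uX : u *m X = 0 by apply/sub_kermxP/nz_row_sub.
set S := \sum_i _; suff S0 : Q *m S *m invmx Q = 0.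
  move/(congr1 (fun A => invmx Q *m A *m Q)): S0.
  by rewrite mulmx0 mul0mx !mulmxA mulVmx // mul1mx mulmxKV.
apply/matrixP => p q; rewrite /S mulmx_sumr mulmx_suml summxE [RHS]mxE.
have [pq|pq] := eqVneq p q.
  transitivity ((u *m X) 0 p); last by rewrite uX mxE.
  rewrite [RHS]mxE; apply: eq_bigr => i _.
  by rewrite -scalemxAr -scalemxAl pq [LHS]mxE [X i q]mxE.
rewrite big1 // => i _; rewrite -scalemxAr -scalemxAl mxE.
have := Qd (M i); rewrite map_f ?mem_enum // => /(_ isT).
by move/(mxpoly.diagonalizable_forP _ Qu) => ->; rewrite ?mulr0.
Qed.

Lemma tdiagE (R : comNzRingType) (n : nat) (x : 'rV[R]_n) (P : 'M[R]_n) :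
  \sum_p x 0 p * P p p = \tr (diag_mx x *m P).
Proof. by rewrite mul_diag_mx; apply: eq_bigr => p _; rewrite mxE. Qed.

(* If a combination of the [P i] equals a diagonal matrix [diag_mx x] with [x] orthogonal to all
   diagonals, then [x] is also a combination of these diagonals, hence [x] is orthogonal to itself. *)
Lemma diag_dual (R : realType) (n m : nat) (P : 'I_m -> 'M[R]_n) :
  (forall i, P i *m P i = P i) -> (forall i j, comm_mx (P i) (P j)) ->
  (forall a : 'rV_m, \sum_i a 0 i *: P i = 0 -> a = 0) ->
  (forall x, (forall i, tdiag x (P i) = 0) -> forall i, comm_mx (diag_mx x) (P i)) ->
  forall b : 'rV_m, exists x : 'rV_n, forall i, tdiag x (P i) = b 0 i.
Proof.
move=> Pid Pc Pfree PW b.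
pose D := \matrix_(p < n, i < m) P i p p.
have Dx (x : 'rV_n) i : (x *m D) 0 i = tdiag x (P i).
  by rewrite mxE; apply: eq_bigr => p _; rewrite mxE.
have [rD|rD] := eqVneq (\rank D) m.
  exists (b *m pinvmx D) => i; rewrite -Dx mulmxKpV //.
  by apply: submx_full; rewrite /row_full rD.
have {}rD : (\rank D < m)%N by rewrite ltn_neqAle rD rank_leq_col.
exfalso.
pose K := row_base (kermx D); set s := \rank (kermx D) in K.
have KD : K *m D = 0 by apply/sub_kermxP; rewrite eq_row_base.
have Kx j i : tdiag (row j K) (P i) = 0 by rewrite -Dx -row_mul KD row0 mxE.
(* The kernel of [D] has dimension [s = n - \rank D] and [\rank D < m], so the [m] projections and
   the [s] diagonal matrices together outnumber the dimension. *)
have nN : (n < m + s)%N by rewrite /s mxrank_ker; have := rank_leq_row D; lia.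
pose M i := match fintype.split i with inl i => P i | inr j => diag_mx (row j K) end.
have [|i|u un0] := @codiag_dependent _ n (m + s) M nN.
- move=> i j; rewrite /M; case: (fintype.split i) => i'; case: (fintype.split j) => j' //.
  + by apply/esym/PW => q; exact: Kx.
  + by apply: PW => q; exact: Kx.
  + by rewrite /comm_mx diag_mxC.
- rewrite /M; case: (fintype.split i) => j; first exact: idem_diagonalizable.
  exact: mxpoly.diagonalizable_diag.
pose a := lsubmx u; pose w := rsubmx u *m K.
rewrite big_split_ord /= => uM.
have wE : \sum_(j < s) u 0 (rshift m j) *: M (rshift m j) = diag_mx w.
  rewrite /w mulmx_sum_row linear_sum /=; apply: eq_bigr => j _.
  by rewrite linearZ /= mxE /M (unsplitK (inr j)).
have aE : \sum_(i < m) u 0 (lshift s i) *: M (lshift s i) = \sum_i a 0 i *: P i.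
  by apply: eq_bigr => i _; rewrite mxE /M (unsplitK (inl i)).
rewrite wE aE in uM.
have wD : w *m D = 0 by rewrite /w -mulmxA KD mulmx0.
have w0 : w = 0.
  have dw p : diag_mx w p p = w 0 p by rewrite [LHS]mxE eqxx.
  have : \tr (diag_mx w *m (\sum_i a 0 i *: P i + diag_mx w)) = 0.
    by rewrite uM mulmx0 mxtrace0.
  rewrite mulmxDr linearD /= mulmx_sumr linear_sum /= big1 => [|i _]; last first.
    by rewrite -scalemxAr linearZ /= -tdiagE -/(tdiag w (P i)) -Dx wD [X in _ * X]mxE mulr0.
  rewrite add0r -tdiagE => /eqP; rewrite psumr_eq0 => [/allP w0|p _]; last first.
    by rewrite dw -expr2 sqr_ge0.
  apply/rowP => p; have := w0 p (mem_index_enum _).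
  by rewrite /= dw [RHS]mxE -expr2 sqrf_eq0 => /eqP.
rewrite w0 linear0 addr0 in uM.
have a0 := Pfree _ uM.
have : rsubmx u = 0.
  apply: (row_free_inj (row_base_free (kermx D))).
  by rewrite -/K -/w w0 mul0mx.
by move=> u20; case/eqP: un0; rewrite -[u]hsubmxK -/a a0 u20 row_mx0.
Qed.

(** * Subgroups of the integer lattice *)

Lemma int_subgroup_cyclic (T : set int) : T 0 -> (forall x y, T x -> T y -> T (x - y)) ->
  exists2 d, T d & forall x, T x -> exists q, x = d * q.
Proof.
move=> T0 TB.
have TN x : T x -> T (- x) by rewrite -[- x]sub0r; exact: TB.
have TM x q : T x -> T (x * q).
  move=> Tx; have TMn m : T (x * m%:Z).
    elim: m => [|m IH]; first by rewrite mulr0.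
    rewrite (_ : x * m.+1 = x * m%:Z - - x); last by rewrite opprK -addn1 PoszD mulrDr mulr1.
    by apply: TB => //; exact: TN.
  case: (intP q) => [|m|m]; rewrite ?mulr0 // ?mulrN //.
  exact: TN.
have [[d [Td d0]]|Tz] := pselect (exists d, T d /\ d != 0); last first.
  exists 0 => // x Tx; exists 0; rewrite mulr0; apply/eqP.
  by apply: contrapT => /negP x0; apply: Tz; exists x.
have exn : exists m, `[< (0 < m)%N /\ T m%:Z >].
  exists `|d|%N; apply/asboolP; rewrite absz_gt0; split => //.
  by rewrite abszE; case: (ger0P d) => _ //; exact: TN.
case: (ex_minnP exn) => m /asboolP[m0 Tm] mmin.
exists m%:Z => // x Tx; exists (x %/ m)%Z.
rewrite mulrC {1}(divz_eq x m) [X in _ + X](_ : _ = 0) ?addr0 //.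
have Tr : T (x %% m)%Z.
  rewrite (_ : (x %% m)%Z = x - m%:Z * (x %/ m)%Z); first by apply: TB => //; exact: TM.
  by rewrite [X in X - _](divz_eq x m) [X in X + _ - _]mulrC addrAC subrr add0r.
have r0 : (0 <= x %% m)%Z by apply: modz_ge0; lia.
have rm : (x %% m < m)%Z by apply: ltz_pmod; lia.
have [r rE] : exists r : nat, (x %% m)%Z = r%:Z.
  by exists `|(x %% m)%Z|%N; rewrite gez0_abs.
rewrite rE in rm Tr *; case: r rm Tr {rE} => // r rm Tr.
by have := mmin r.+1; rewrite asboolT // => /(_ isT); lia.
Qed.

Lemma col_mx0_dsub (V : nmodType) (n : nat) (z : 'cV[V]_(1 + n)) :
  z 0 0 = 0 -> col_mx 0 (dsubmx z) = z.
Proof.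
move=> z0; rewrite -[RHS]vsubmxK; congr col_mx; apply/matrixP => i j.
by rewrite !ord1 !mxE lshift0 z0.
Qed.

(** Induction on the dimension: the first coordinates of [H] form a cyclic group, and a vector
    attaining its generator, unless that is zero, is added to a basis of the vectors with first
    coordinate zero. *)
Lemma subgroup_basis (n : nat) (H : set 'cV[int]_n) :
  H 0 -> (forall x y, H x -> H y -> H (x - y)) ->
  exists k (Z : 'M[int]_(n, k)), gram Z != 0 /\
    (forall z, H z <-> exists w, z = Z *m w).
Proof.
elim: n H => [|n IH] H H0 HB.
  exists 0%N, 0; split; first by rewrite /gram det_mx00.
  by move=> z; split=> [_|_]; [exists 0; rewrite [z]flatmx0 mul0mx|rewrite [z]flatmx0].
pose H' := [set y : 'cV[int]_n | H (col_mx (0 : 'M_1) y)].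
have [||k [Z [Z0 ZH]]] := IH H'.
- by rewrite /H' /= col_mx0.
- move=> x y; rewrite /H' /= => Hx Hy.
  by rewrite -[0](subrr (0 : 'M[int]_1)) -add_col_mx -opp_col_mx; exact: HB.
pose T := [set t : int | exists2 z : 'cV_(1 + n), H z & z 0 0 = t].
have [||d [v Hv vd] dT] := @int_subgroup_cyclic T.
- by exists 0; rewrite ?mxE.
- by move=> _ _ [x Hx <-] [y Hy <-]; exists (x - y); rewrite ?mxE //; exact: HB.
have HN x : H x -> H (- x) by move=> Hx; rewrite -[- x]sub0r; exact: HB.
have HD x y : H x -> H y -> H (x + y) by move=> Hx /HN Hy; rewrite -[y]opprK; exact: HB.
have HM x (q : int) : H x -> H (q *: x).
  move=> Hx; have HMn m : H (m%:Z *: x).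
    elim: m => [|m IHm]; first by rewrite scale0r.
    by rewrite intS scalerDl scale1r; exact: HD.
  by case: (intP q) => [|m|m]; rewrite ?scale0r // ?scaleNr //; exact: HN.
pose Z' : 'M_(1 + n, k) := col_mx 0 Z.
have HZ' w : H (Z' *m w).
  by rewrite mul_col_mx mul0mx; apply/(ZH (Z *m w)); exists w.
have splitH z : H z -> exists q w, z = v *m q%:M + Z' *m w.
  move=> Hz; have [q qz] := dT (z 0 0) (ex_intro2 _ _ z Hz erefl).
  pose y : 'cV_(1 + n) := z - q *: v.
  have yE : col_mx 0 (dsubmx y) = y by apply: col_mx0_dsub; rewrite !mxE vd qz mulrC subrr.
  have /ZH[w zw] : H' (dsubmx y) by rewrite /H' /= yE; apply: HB => //; exact: HM.
  exists q, w; rewrite mul_mx_scalar mul_col_mx mul0mx -zw yE.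
  by rewrite addrC subrK.
have [d0|d0] := eqVneq d 0.
  have vE : col_mx 0 (dsubmx v) = v by apply: col_mx0_dsub; rewrite vd.
  have /ZH[w0 vw0] : H' (dsubmx v) by rewrite /H' /= vE.
  have vZ : v = Z' *m w0 by rewrite mul_col_mx mul0mx -vw0.
  exists k, Z'; split.
    apply/(@gram_kerP _ (1 + n)) => x; rewrite mul_col_mx mul0mx => /(congr1 (@dsubmx _ 1 n 1)).
    by rewrite col_mxKd linear0; move/gram_kerP: Z0; exact.
  move=> z; split=> [/splitH[q [w ->]]|[w ->]]; last exact: HZ'.
  by exists (w0 *m q%:M + w); rewrite mulmxDr mulmxA -vZ.
exists (1 + k)%N, (row_mx v Z'); split.
  apply/(@gram_kerP _ (1 + n)) => x; rewrite -[x]vsubmxK mul_row_col => E.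
  have x0 : usubmx x = 0.
    move/matrixP/(_ 0 0): (E); rewrite mxE mul_col_mx mul0mx.
    rewrite [X in _ + X](_ : _ = 0) ?addr0; last first.
      by rewrite mxE; case: splitP => [j _|j //]; rewrite mxE.
    rewrite mxE big_ord1 vd [X in _ = X]mxE => /eqP; rewrite mulf_eq0 (negbTE d0) /= => /eqP x0.
    by apply/matrixP => i j; rewrite !ord1 [RHS]mxE.
  move: E; rewrite x0 mulmx0 add0r mul_col_mx mul0mx => /(congr1 (@dsubmx _ 1 n 1)).
  rewrite col_mxKd linear0 => /(gram_kerP Z).1 -> //.
  by rewrite col_mx0.
move=> z; split=> [/splitH[q [w ->]]|[w ->]].
  by exists (col_mx q%:M w); rewrite mul_row_col.
rewrite -[w]vsubmxK mul_row_col; apply: HD => //.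
by rewrite [usubmx w]mx11_scalar mul_mx_scalar; exact: HM.
Qed.

Local Notation "Z ^R" := (map_mx intr Z) (at level 2, format "Z ^R") : ring_scope.

Lemma gram_intr (R : comNzRingType) (n k : nat) (Z : 'M[int]_(n, k)) :
  gram (Z^R : 'M[R]_(n, k)) = (gram Z)%:~R.
Proof. by rewrite /gram -det_map_mx map_mxM; congr (\det (_ *m _)); apply/matrixP => i j; rewrite !mxE. Qed.

Lemma gram_intr_neq0 (R : realFieldType) (n k : nat) (Z : 'M[int]_(n, k)) :
  (gram (Z^R : 'M[R]_(n, k)) != 0) = (gram Z != 0).
Proof. by rewrite gram_intr intr_eq0. Qed.

Lemma gram_neq0_leq (F : realFieldType) (n k : nat) (B : 'M[F]_(n, k)) :
  gram B != 0 -> (k <= n)%N.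
Proof.
move=> B0; have : B^T *m B \in unitmx by rewrite unitmxE unitfE.
rewrite -row_full_unit => /eqP <-.
by rewrite (leq_trans (mxrankM_maxl _ _)) // rank_leq_col.
Qed.

Lemma free_leq (n k : nat) (Z : 'M[int]_(n, k)) : gram Z != 0 -> (k <= n)%N.
Proof. by rewrite -(gram_intr_neq0 rat) => /gram_neq0_leq. Qed.

Lemma gram_unit_mul (R : realFieldType) (n k : nat) (h : 'M[R]_n) (B : 'M[R]_(n, k)) :
  h \in unitmx -> (gram (h *m B) != 0) = (gram B != 0).
Proof.
move=> hu; apply/idP/idP => /gram_kerP Binj; apply/gram_kerP => x.
  by move=> Bx; apply: Binj; rewrite -mulmxA Bx mulmx0.
by rewrite -mulmxA => /(congr1 (mulmx (invmx h))); rewrite mulKmx // mulmx0 => /Binj.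
Qed.

Lemma col_factor (n k l : nat) (I : 'M[int]_(n, k)) (W : 'M[int]_(n, l)) :
  (forall j, exists w, col j W = I *m w) -> exists M, W = I *m M.
Proof.
move=> /choice[f Hf]; exists (\matrix_(i, j) f j i 0); apply/matrixP => i j.
have /matrixP/(_ i 0) := Hf j; rewrite !mxE => ->.
by apply: eq_bigr => m _; rewrite !mxE.
Qed.

(* Applied to [N = annih Z2 *m Z1], the columns of [Z1 *m I] span the intersection of the two
   subspaces, and [Y] lifts a basis of the image of [Z1] modulo the span of [Z2]. *)
Lemma adapted_basis (m k : nat) (N : 'M[int]_(m, k)) :
  exists a c (I : 'M[int]_(k, a)) (Y : 'M[int]_(k, c)),
  [/\ k = (a + c)%N, N *m I = 0, gram (N *m Y) != 0,
   forall l (W : 'M_(k, l)), N *m W = 0 -> exists M, W = I *m M &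
   (exists V, row_mx I Y *m V = 1%:M) /\ gram (row_mx I Y) != 0].
Proof.
have [||a [I [I0 HI]]] := @subgroup_basis k [set z | N *m z = 0].
- by rewrite /= mulmx0.
- by move=> x y /=; rewrite mulmxBr => -> ->; rewrite subr0.
have [||c [B [B0 HB]]] := @subgroup_basis m (range (mulmx N : 'cV_k -> 'cV_m)).
- by exists 0 => //; rewrite mulmx0.
- by move=> _ _ [x _ <-] [y _ <-]; exists (x - y) => //; rewrite mulmxBr.
have [Y BY] : exists Y, B = N *m Y.
  apply: col_factor => j; have [|y _ Hy] := (HB (col j B)).2; last by exists y.
  by exists (delta_mx j 0); rewrite colE.
have NI : N *m I = 0.
  apply/matrixP => i j; have /= := (HI (I *m delta_mx j 0)).2 (ex_intro _ _ erefl).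
  by rewrite mulmxA -colE => /matrixP/(_ i 0); rewrite !mxE.
have ker l (W : 'M_(k, l)) : N *m W = 0 -> exists M, W = I *m M.
  move=> NW; apply: col_factor => j; apply/HI => /=.
  by rewrite colE mulmxA NW mul0mx.
have [V IYV] : exists V, 1%:M = row_mx I Y *m V.
  apply: col_factor => j; set z := col j _.
  have [w zw] := (HB (N *m z)).1 (ex_intro2 _ _ z Logic.I erefl).
  have [M zM] : exists M, z - Y *m w = I *m M.
    by apply: ker; rewrite mulmxBr zw BY mulmxA subrr.
  by exists (col_mx M w); rewrite mul_row_col -zM subrK.
have IY0 : gram (row_mx I Y) != 0.
  apply/gram_kerP => x; rewrite -[x]vsubmxK mul_row_col => E.
  have x2 : dsubmx x = 0.
    apply: (gram_kerP B).1 => //; rewrite BY -mulmxA -[Y *m _](addKr (I *m usubmx x)) E.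
    by rewrite addr0 mulmxN mulmxA NI mul0mx oppr0.
  move: E; rewrite x2 mulmx0 addr0 => /(gram_kerP I).1 -> //.
  by rewrite col_mx0.
exists a, c, I, Y; split => //; last 1 first.
- by split=> //; exists V.
- apply/eqP; rewrite eqn_leq (free_leq IY0) andbT.
  apply: (@free_leq _ _ V); apply/gram_kerP => x /(congr1 (mulmx (row_mx I Y))).
  by rewrite mulmxA -IYV mul1mx mulmx0.
- by rewrite -BY.
Qed.

(** A right-invertible [U] is square once [k = a + c], hence of determinant 1 or -1. The equation is
    a hypothesis because [k] and [a + c] are not convertible. *)
Lemma adapted_gram (R : realFieldType) (n k a c : nat) (A : 'M[R]_(n, k)) (U : 'M[int]_(k, a + c)) :
  k = (a + c)%N -> (exists V, U *m V = 1%:M) -> gram (A *m U^R) = gram A.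
Proof.
move=> kac; move: U; case: _ / kac => U [V UV]; rewrite gram_mulmx det_map_mx.
have Uu : \det U \is a GRing.unit by have [] := mulmx1_unit UV.
suff P2 : \det U ^+ 2 = 1 by rewrite -rmorphXn /= P2 mul1r.
by move: Uu => /pred2P[] ->.
Qed.

(* An integer multiple of the orthogonal projection along the span of [Z]: its kernel is that span. *)
Definition annih (n k : nat) (Z : 'M[int]_(n, k)) : 'M[int]_n :=
  (gram Z)%:M - Z *m \adj (Z^T *m Z) *m Z^T.

Lemma annih_mul (n k : nat) (Z : 'M[int]_(n, k)) : annih Z *m Z = 0.
Proof.
by rewrite mulmxBl -!mulmxA mul_adj_mx mul_scalar_mx mul_mx_scalar subrr.
Qed.

Lemma annih_ker (n k l : nat) (Z : 'M[int]_(n, k)) (X : 'M_(n, l)) :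
  annih Z *m X = 0 -> exists W, gram Z *: X = Z *m W.
Proof.
move=> /eqP; rewrite mulmxBl subr_eq0 mul_scalar_mx => /eqP ->.
by eexists; rewrite -!mulmxA.
Qed.

Lemma intr_mxM (R : pzRingType) (m n p : nat) (A : 'M[int]_(m, n)) (B : 'M[int]_(n, p)) :
  (A *m B)^R = A^R *m B^R :> 'M[R]_(m, p).
Proof. exact: map_mxM. Qed.

Lemma proj_commensurable (R : realFieldType) (n k l : nat) (h : 'M[R]_n)
    (Z : 'M[int]_(n, k)) (X : 'M[int]_(n, l)) (d : int) (W : 'M_(k, l)) :
  h \in unitmx -> gram Z != 0 -> d != 0 -> d *: X = Z *m W ->
  proj (h *m Z^R) *m proj (h *m X^R) = proj (h *m X^R).
Proof.
move=> hu Z0 d0 XW.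
apply: (@proj_subl _ _ _ _ _ _ ((d%:~R)^-1 *: W^R)).
  by rewrite gram_unit_mul // gram_intr_neq0.
rewrite -scalemxAr -mulmxA -intr_mxM -XW map_mxZ /= -scalemxAr scalerA mulVf ?scale1r //.
by rewrite intr_eq0.
Qed.

(** [I] spans the intersection of the two real spans and [S] spans their sum; [c1 = 0] means that
    the first span lies in the second. *)
Lemma submodular (R : realFieldType) (n k l : nat) (h : 'M[R]_n)
    (Z1 : 'M[int]_(n, k)) (Z2 : 'M[int]_(n, l)) :
  h \in unitmx -> gram Z1 != 0 -> gram Z2 != 0 ->
  exists a c1 c2 (I : 'M[int]_(n, a)) (S : 'M[int]_(n, a + c1 + c2)),
  [/\ k = (a + c1)%N, l = (a + c2)%N, gram I != 0 /\ gram S != 0,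
      gram (h *m S^R) * gram (h *m I^R) <= gram (h *m Z1^R) * gram (h *m Z2^R) &
      c1 = 0%N -> proj (h *m Z2^R) *m proj (h *m Z1^R) = proj (h *m Z1^R)].
Proof.
move=> hu Z10 Z20.
have [a [c1 [I1 [Y1 [k1 NI1 NY1 ker1 [UV1 IY1]]]]]] := adapted_basis (annih Z2 *m Z1).
have [a2 [c2 [I2 [Y2 [l2 NI2 NY2 ker2 [UV2 IY2]]]]]] := adapted_basis (annih Z1 *m Z2).
have ZU0 m p (Z : 'M[int]_(n, m)) (U : 'M[int]_(m, p)) :
    gram Z != 0 -> gram U != 0 -> gram (Z *m U) != 0.
  move=> /gram_kerP Zi /gram_kerP Ui; apply/gram_kerP => x.
  by rewrite -mulmxA => /Zi/Ui.
have {}IY1 := ZU0 _ _ _ _ Z10 IY1; have {}IY2 := ZU0 _ _ _ _ Z20 IY2.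
rewrite !mul_mx_row in IY1 IY2.
have free_l m p (A : 'M[int]_(n, m)) (B : 'M[int]_(n, p)) : gram (row_mx A B) != 0 -> gram A != 0.
  by rewrite -(gram_intr_neq0 R) map_row_mx => /gram_row_mxl; rewrite gram_intr_neq0.
have I10 := free_l _ _ _ _ IY1; have I20 := free_l _ _ _ _ IY2.
have [M2 IM2] : exists M2, gram Z2 *: (Z1 *m I1) = (Z2 *m I2) *m M2.
  have [|W IW] := @annih_ker _ _ _ Z2 (Z1 *m I1); first by rewrite mulmxA.
  have [|M WM] := ker2 _ W; last by exists M; rewrite IW WM mulmxA.
  by rewrite -mulmxA -IW -scalemxAr mulmxA annih_mul mul0mx scaler0.
have [M1 IM1] : exists M1, gram Z1 *: (Z2 *m I2) = (Z1 *m I1) *m M1.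
  have [|W IW] := @annih_ker _ _ _ Z1 (Z2 *m I2); first by rewrite mulmxA.
  have [|M WM] := ker1 _ W; last by exists M; rewrite IW WM mulmxA.
  by rewrite -mulmxA -IW -scalemxAr mulmxA annih_mul mul0mx scaler0.
have Mfree m p (A : 'M[int]_(n, m)) (B : 'M[int]_(n, p)) (d : int) M :
    gram A != 0 -> d != 0 -> d *: A = B *m M -> (m <= p)%N.
  move=> A0 d0 AM; apply: (@free_leq _ _ M); apply/gram_kerP => x Mx.
  apply: (gram_kerP A).1 => //; apply/eqP.
  have : d *: (A *m x) = 0 by rewrite scalemxAl AM -mulmxA Mx mulmx0.
  by move/eqP; rewrite scalemx_eq0 (negbTE d0).
(* A nonzero integer multiple of each basis of the intersection is an integer combination of the
   other, so the two have the same length. *)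
have aa : a2 = a.
  by apply/eqP; rewrite eqn_leq (Mfree _ _ _ _ _ _ I20 Z10 IM1) (Mfree _ _ _ _ _ _ I10 Z20 IM2).
subst a2.
set J1 := Z1 *m I1 in IY1 I10 IM1 IM2; set X1 := Z1 *m Y1 in IY1.
set J2 := Z2 *m I2 in IY2 I20 IM1 IM2; set X2 := Z2 *m Y2 in IY2.
exists a, c1, c2, J2, (row_mx (row_mx J1 X1) X2).
have gr0 p (A : 'M[int]_(n, p)) : gram A != 0 -> gram (h *m A^R) != 0.
  by rewrite gram_unit_mul // gram_intr_neq0.
have S0 : gram (row_mx (row_mx J1 X1) X2) != 0.
  apply/gram_kerP => x; rewrite -[x]vsubmxK mul_row_col => E.
  have x2 : dsubmx x = 0.
    apply: (gram_kerP _).1 NY2 _ _.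
    rewrite -!mulmxA (mulmxA Z2) -/X2 -[X2 *m _](addKr (row_mx J1 X1 *m usubmx x)) E.
    by rewrite addr0 mulmxN mulmxA /J1 /X1 -mul_mx_row mulmxA annih_mul !mul0mx oppr0.
  move: E; rewrite x2 mulmx0 addr0 => /(gram_kerP _).1 -> //.
  by rewrite col_mx0.
split => //.
  have g1 : gram (h *m Z1^R) = gram (row_mx (h *m J1^R) (h *m X1^R)).
    rewrite -(adapted_gram _ k1 UV1) -mulmxA -intr_mxM mul_mx_row -/J1 -/X1.
    by rewrite map_row_mx mul_mx_row.
  have g2 : gram (h *m Z2^R) = gram (row_mx (h *m J2^R) (h *m X2^R)).
    rewrite -(adapted_gram _ l2 UV2) -mulmxA -intr_mxM mul_mx_row -/J2 -/X2.
    by rewrite map_row_mx mul_mx_row.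
  rewrite g1 g2 !map_row_mx !mul_mx_row.
  (* [J1] and [J2] may generate different lattices, but they span the same subspace, so [X2] has the
     same height over both. *)
  have PP : proj (h *m J1^R) = proj (h *m J2^R).
    rewrite -[RHS](proj_commensurable hu I10 Z10 IM1) -[LHS]tr_proj.
    by rewrite -{1}(proj_commensurable hu I20 Z20 IM2) trmx_mul !tr_proj.
  have IY1' : gram (row_mx (h *m J1^R) (h *m X1^R)) != 0.
    by rewrite -mul_mx_row -map_row_mx gr0.
  have := gram_submod (h *m X2^R) IY1' (gr0 _ _ I10).
  rewrite (gram_row_mx (h *m X2^R) (gr0 _ _ I10)) (gram_row_mx (h *m X2^R) (gr0 _ _ I20)) PP.
  set u := gram (row_mx (row_mx _ _) _); set v := gram (row_mx _ _); set w := gram (_ *m (h *m _)).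
  have : 0 < gram (h *m J1^R) by rewrite gram_gt0 gr0.
  have : 0 < gram (h *m J2^R) by rewrite gram_gt0 gr0.
  move: (gram _) (gram _) => x y x0 y0.
  by rewrite mulrCA [u * x]mulrC ler_pM2l // => uvw; rewrite mulrCA [u * y]mulrC ler_pM2l.
move=> c10; move: Y1 k1 UV1 NY1 X1 IY1 S0; rewrite c10 => Y1 k1 [V UV1] NY1 X1 IY1 S0.
have Z1J : Z1 = J1 *m usubmx V.
  rewrite -[LHS]mulmx1 -UV1 -[V]vsubmxK mul_row_col mulmxDr [dsubmx _]flatmx0 mulmx0 mulmx0 addr0.
  by rewrite mulmxA col_mxKu.
apply: (@proj_commensurable _ _ _ _ _ _ _ (gram Z2) (I2 *m M2 *m usubmx V)) => //.
by rewrite [in LHS]Z1J scalemxAl IM2 /J2 !mulmxA.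
Qed.

(** * Discreteness of the weighted covolumes *)

Lemma finite_int_box (T : finType) (N : nat) :
  finite_set [set p : {ffun T -> int} | forall i, `|p i| <= N%:Z].
Proof.
pose g (q : {ffun T -> 'I_(N + N).+1}) : {ffun T -> int} := [ffun i => (q i)%:Z - N%:Z].
apply: (@sub_finite_set _ _ (g @` setT)); last exact/finite_image/finite_finset.
move=> p /= pN; exists [ffun i => inord `|(p i + N%:Z)%R|%N] => //.
apply/ffunP => i; rewrite !ffunE; have := pN i; rewrite ler_norml => /andP[p1 p2].
by rewrite inordK; lia.
Qed.

Lemma finite_gap (R : realFieldType) (S : set R) (m : R) : finite_set S ->
  exists2 e, 0 < e & forall x, S x -> x < m + e -> x <= m.
Proof.
move=> /finite_seqP[s ->]; elim: s => [|y s [e e0 IH]]; first by exists 1.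
have [ym|ym] := leP y m.
  by exists e => // x; rewrite /= inE => /predU1P[-> //|]; exact: IH.
exists (Num.min e (y - m)); first by rewrite lt_min e0 subr_gt0.
move=> x; rewrite /= inE => /predU1P[->|xs].
  by rewrite -ltrBlDl lt_min ltxx andbF.
by rewrite -ltrBlDl lt_min => /andP[+ _]; rewrite ltrBlDl; exact: IH.
Qed.

Section Gap.
Variables (R : realType) (n : nat).

Lemma det_rowsub_mul (k : nat) (h : 'M[R]_n) (B : 'M[R]_(n, k)) (f : {ffun 'I_k -> 'I_n}) :
  \det (rowsub f (h *m B)) = (k`!%:R)^-1 *
    \sum_(g : {ffun 'I_k -> 'I_n}) \det (colsub g (rowsub f h)) * \det (rowsub g B).
Proof. by rewrite -mul_rowsub_mx cauchy_binet_field. Qed.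

Lemma det_rowsub_le (k : nat) (B : 'M[R]_(n, k)) (f : {ffun 'I_k -> 'I_n}) :
  `|\det (rowsub f B)| <= 1 + k`!%:R * gram B.
Proof.
have H : `|\det (rowsub f B)| ^+ 2 <= k`!%:R * gram B.
  rewrite real_normK ?num_real // mulr_natl gram_sum (bigD1 f) //= lerDl sumr_ge0 // => g _.
  exact: sqr_ge0.
apply: le_trans (lerD (lexx 1) H); set d := `|_|; nra.
Qed.

(** The Gram determinant depends only on the integer minors [pl Z], and these are bounded because
    they are recovered from the bounded minors of [h *m Z^R] through the inverse of [h]. Many [Z]
    may share a value, so finiteness concerns the values. *)
Lemma gram_values_finite (k : nat) (h : 'M[R]_n) (K : R) : h \in unitmx ->
  finite_set [set gram (h *m Z^R) | Z in [set Z : 'M[int]_(n, k) | gram (h *m Z^R) <= K]].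
Proof.
move=> hu.
pose pl (Z : 'M[int]_(n, k)) := [ffun f : {ffun 'I_k -> 'I_n} => \det (rowsub f Z)].
pose G (p : {ffun {ffun 'I_k -> 'I_n} -> int}) : R := (k`!%:R)^-1 *
  \sum_(f : {ffun 'I_k -> 'I_n}) ((k`!%:R)^-1 *
    \sum_(g : {ffun 'I_k -> 'I_n}) \det (colsub g (rowsub f h)) * (p g)%:~R) ^+ 2.
have plE (Z : 'M[int]_(n, k)) (f : {ffun 'I_k -> 'I_n}) : \det (rowsub f (Z^R : 'M[R]_(n, k))) = (pl Z f)%:~R.
  by rewrite ffunE -det_map_mx; congr (\det _); apply/matrixP => i j; rewrite !mxE.
have GE Z : gram (h *m Z^R) = G (pl Z).
  rewrite gramE; congr (_ * _); apply: eq_bigr => f _; congr (_ ^+ 2).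
  by rewrite det_rowsub_mul; congr (_ * _); apply: eq_bigr => g _; rewrite plE.
pose C : R := \sum_(f : {ffun 'I_k -> 'I_n}) (k`!%:R)^-1 *
  \sum_(g : {ffun 'I_k -> 'I_n}) `|\det (colsub g (rowsub f (invmx h)))| * (1 + k`!%:R * K).
pose B : set R := G @` [set p : {ffun {ffun 'I_k -> 'I_n} -> int} |
  forall f, `|p f| <= (Num.bound C)%:Z].
have Bfin : finite_set B by exact/finite_image/finite_int_box.
apply: (sub_finite_set _ Bfin).
move=> _ [Z /= ZK <-]; exists (pl Z); last by rewrite GE.
move=> f /=; rewrite -(ler_int R) intr_norm -plE.
have K0 : 0 <= K by apply: le_trans ZK; exact: gram_ge0.
have C0 f' : 0 <= (k`!%:R)^-1 * \sum_(g : {ffun 'I_k -> 'I_n})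
    `|\det (colsub g (rowsub f' (invmx h)))| * (1 + k`!%:R * K).
  rewrite mulr_ge0 ?invr_ge0 ?ler0n // sumr_ge0 // => g _.
  by rewrite mulr_ge0 // addr_ge0 // mulr_ge0 ?ler0n.
apply: le_trans (ltW (archi_boundP _)); last by rewrite sumr_ge0.
rewrite -[Z^R](mulKmx hu) det_rowsub_mul normrM ger0_norm ?invr_ge0 ?ler0n //.
rewrite /C [leRHS](bigD1 f) //= -[leLHS]addr0 lerD ?sumr_ge0 //.
rewrite ler_wpM2l ?invr_ge0 ?ler0n // (le_trans (ler_norm_sum _ _ _)) // ler_sum // => g _.
rewrite normrM ler_wpM2l // (le_trans (det_rowsub_le _ _)) // lerD2l ler_wpM2l ?ler0n //.
Qed.

(* The strict concavity of the exponent makes the weighted covolume strictly submodular on pairs of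
   incomparable subgroups. *)
Definition rank_wt (eps : R) (k : nat) : R := expR (eps * (k%:R * (n%:R - k%:R))).

Definition Phi (eps : R) (h : 'M[R]_n) (k : nat) (Z : 'M[int]_(n, k)) : R := gram (h *m Z^R) * rank_wt eps k.

Variable eps : R.

Lemma rank_wt_gt0 k : 0 < rank_wt eps k. Proof. exact: expR_gt0. Qed.

Lemma Phi_gt0 (h : 'M[R]_n) k (Z : 'M[int]_(n, k)) : h \in unitmx -> gram Z != 0 -> 0 < Phi eps h Z.
Proof. by move=> hu Z0; rewrite mulr_gt0 ?rank_wt_gt0 // gram_gt0 gram_unit_mul // gram_intr_neq0. Qed.

Lemma Phi_gap (h : 'M[R]_n) (m : R) : h \in unitmx -> exists2 e, 0 < e &
  forall k (Z : 'M[int]_(n, k)), gram Z != 0 -> Phi eps h Z < m + e -> Phi eps h Z <= m.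
Proof.
move=> hu.
have gapk k : exists e, 0 < e /\
    forall Z : 'M[int]_(n, k), Phi eps h Z < m + e -> Phi eps h Z <= m.
  have [e e0 He] := finite_gap (m / rank_wt eps k)
    (@gram_values_finite k h (m / rank_wt eps k + 1) hu).
  (* The cap 1 keeps the Gram determinants below the bound [m / rank_wt eps k + 1] used for
     finiteness. *)
  exists (Num.min e 1 * rank_wt eps k); split; first by rewrite mulr_gt0 ?rank_wt_gt0 // lt_min e0 ltr01.
  move=> Z; rewrite /Phi -ler_pdivlMr ?rank_wt_gt0 // -ltr_pdivlMr ?rank_wt_gt0 // mulrDl mulfK ?gt_eqF ?rank_wt_gt0 //.
  move=> Zlt; apply: He; last first.
    by apply: lt_le_trans Zlt _; rewrite lerD2l ge_min lexx.
  exists Z => //=; apply: ltW; apply: lt_le_trans Zlt _.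
  by rewrite lerD2l ge_min lexx orbT.
have /choice[e He] := gapk.
exists (\big[Num.min/1]_(k < n.+1) e k).
  by apply: lt_bigmin => // k _; have [] := He k.
move=> k Z Z0 Zlt; apply: (He k).2; apply: lt_le_trans Zlt _; rewrite lerD2l.
have kn : (k < n.+1)%N by rewrite ltnS (free_leq Z0).
exact: (bigmin_le _ (Ordinal kn) (fun k : 'I_n.+1 => e k)).
Qed.

End Gap.

(** * The extremal lattice *)

Lemma proj_full (R : realFieldType) (n k : nat) (B : 'M[R]_(n, k)) :
  gram B != 0 -> k = n -> proj B = 1%:M.
Proof.
move=> B0 kn; subst k; have Bu : B \in unitmx.
  by move: B0; rewrite /gram det_mulmx mulf_eq0 negb_or unitmxE unitfE => /andP[].
by rewrite -[LHS](mulmxK Bu) proj_mulK // mulmxV.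
Qed.

(* The trace of the square of [\sum_i a 0 i *: P i] is the sum over [t] of the squares of the tail
   sums [\sum_(i | t < r i) a 0 i], because the trace of [P i *m P j] is [minn (r i) (r j)]. *)
Lemma nested_proj_free (R : realFieldType) (n M : nat) (P : 'I_M -> 'M[R]_n) (r : 'I_M -> nat) :
  injective r -> (forall i, 0 < r i <= n)%N -> (forall i, \tr (P i) = (r i)%:R) ->
  (forall i j, (r i <= r j)%N -> P i *m P j = P i /\ P j *m P i = P i) ->
  forall a : 'rV_M, \sum_i a 0 i *: P i = 0 -> a = 0.
Proof.
move=> rinj rn trP nest a aP0.
pose T t := \sum_(i | (t < r i)%N) a 0 i.
have minE i j : \tr (P i *m P j) = \sum_(t < n) ((t < r i)%:R * (t < r j)%:R).
  have cnt k : (k <= n)%N -> k%:R = \sum_(t < n) (t < k)%:R :> R.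
    move=> kn; transitivity (\sum_(t < k) (1 : R)); first by rewrite sumr_const card_ord.
    rewrite (big_ord_widen n (fun=> 1)) // big_mkcond; apply: eq_bigr => t _.
    by case: ifP.
  have [rij|/ltnW rji] := leqP (r i) (r j).
    rewrite (nest i j rij).1 trP cnt; last by case/andP: (rn i).
    apply: eq_bigr => t _; case: (ltnP t (r i)) => ti; rewrite ?mul0r ?mul1r //.
    by rewrite (leq_trans ti rij).
  rewrite (nest j i rji).2 trP cnt; last by case/andP: (rn j).
  apply: eq_bigr => t _; case: (ltnP t (r j)) => tj; rewrite ?mulr0 ?mulr1 //.
  by rewrite (leq_trans tj rji).
have T0 t : T t = 0.
  have [nt|tn] := leqP n t.
    by rewrite /T big_pred0 // => i; have := rn i; lia.
  have : \sum_(t < n) T t ^+ 2 = 0.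
    transitivity (\tr ((\sum_i a 0 i *: P i) *m (\sum_i a 0 i *: P i))); last first.
      by rewrite aP0 mul0mx mxtrace0.
    rewrite mulmx_suml linear_sum /=.
    under [RHS]eq_bigr => i _ do rewrite mulmx_sumr linear_sum /=.
    under [RHS]eq_bigr => i _ do under eq_bigr => j _ do
      rewrite -scalemxAl -scalemxAr !linearZ /= minE !mulr_sumr.
    under [RHS]eq_bigr => i _ do rewrite exchange_big /=.
    rewrite exchange_big /=; apply: eq_bigr => s _; rewrite expr2 /T mulr_suml big_mkcond.
    apply: eq_bigr => i _; case: (s < r i)%N; last by rewrite big1 // => j _; rewrite mul0r !mulr0.
    rewrite mulr_sumr big_mkcond; apply: eq_bigr => j _.
    by case: (s < r j)%N; rewrite /= ?mulr1 // ?mulr0.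
  move/eqP; rewrite psumr_eq0 => [/allP T0|s _]; last exact: sqr_ge0.
  by have := T0 (Ordinal tn) (mem_index_enum _); rewrite /= sqrf_eq0 => /eqP.
apply/rowP => i; rewrite [RHS]mxE.
(* Since [r] is injective, the two consecutive tail sums differ exactly by [a 0 i]. *)
have : T (r i).-1 - T (r i) = 0 by rewrite !T0 subrr.
rewrite /T (bigD1 i) /=; last by have := rn i; lia.
rewrite [X in _ + X - _](_ : _ = T (r i)) ?addrK // /T; apply: eq_bigl => j.
have [->|ji] := eqVneq j i; first by rewrite ltnn andbF.
have : r j <> r i by move=> /rinj/eqP; rewrite (negbTE ji).
by rewrite andbT; have := rn i; lia.
Qed.

Section Local.
Variables (R : realType) (n : nat) (eps : R).
Hypothesis eps_gt0 : 0 < eps.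
Implicit Types (h : 'M[R]_n) (m : R).

(** The exponents of the two sides differ by [2 * b * c * eps]. *)
Lemma rank_wt_submod a b c : (0 < b)%N -> (0 < c)%N ->
  rank_wt n eps (a + b + c) * rank_wt n eps a < rank_wt n eps (a + b) * rank_wt n eps (a + c).
Proof.
move=> b0 c0; rewrite -!expRD ltr_expR -!mulrDr ltr_pM2l // !natrD.
have bc : 0 < b%:R * c%:R :> R by rewrite mulr_gt0 ?ltr0n.
nra.
Qed.

(** The last clause says that no lattice in the diagonal orbit of [h] has infimum above [m]; at
    [x = 0] it makes [m] the infimum at [h] itself. *)
Definition extremal h m := [/\ h \in unitmx, \det h ^+ 2 = 1,
  forall k (Z : 'M[int]_(n, k)), gram Z != 0 -> m <= Phi eps h Z &
  forall x : 'rV[R]_n, \sum_p x 0 p = 0 -> forall e, 0 < e ->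
    exists k (Z : 'M[int]_(n, k)), gram Z != 0 /\ Phi eps (expmx x *m h) Z < m + e].

Definition minimizer h m k (Z : 'M[int]_(n, k)) := gram Z != 0 /\ Phi eps h Z = m.

(** For incomparable spans, the values of [Phi] at the intersection and the sum would have product
    below [m ^+ 2], since the weight is strictly submodular. *)
Lemma minimizer_nested h m k l (Z1 : 'M[int]_(n, k)) (Z2 : 'M[int]_(n, l)) :
  h \in unitmx -> 0 < m ->
  (forall k (Z : 'M[int]_(n, k)), gram Z != 0 -> m <= Phi eps h Z) ->
  minimizer h m Z1 -> minimizer h m Z2 -> (k <= l)%N ->
  proj (h *m Z2^R) *m proj (h *m Z1^R) = proj (h *m Z1^R).
Proof.
move=> hu m0 hm [Z10 Z1m] [Z20 Z2m] kl.
have [a [c1 [c2 [I [S [ka la [I0 S0] IS c10]]]]]] := submodular hu Z10 Z20.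
case: c1 => [|c1] in S S0 IS ka c10; first exact: c10.
case: c2 => [|c2] in S S0 IS la; first by lia.
have := hm _ _ I0; have := hm _ _ S0; move: Z1m Z2m; rewrite /Phi => Z1m Z2m Sm Im.
have W : rank_wt n eps (a + c1.+1 + c2.+1) * rank_wt n eps a < rank_wt n eps k * rank_wt n eps l.
  by rewrite ka la rank_wt_submod.
have := ler_pM (ltW m0) (ltW m0) Sm Im.
rewrite mulrACA => mm.
have : gram (h *m S^R) * gram (h *m I^R) * (rank_wt n eps (a + c1.+1 + c2.+1) * rank_wt n eps a) <
  gram (h *m Z1^R) * gram (h *m Z2^R) * (rank_wt n eps k * rank_wt n eps l).
  apply: le_lt_trans (ler_wpM2r _ IS) _; first by rewrite mulr_ge0 ?ltW ?rank_wt_gt0.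
  by rewrite ltr_pM2l // mulr_gt0 // gram_gt0 gram_unit_mul // gram_intr_neq0.
by rewrite [ltRHS]mulrACA Z1m Z2m => /(le_lt_trans mm); rewrite ltxx.
Qed.

Lemma minimizer_proj h m k (Z1 Z2 : 'M[int]_(n, k)) :
  h \in unitmx -> 0 < m ->
  (forall k (Z : 'M[int]_(n, k)), gram Z != 0 -> m <= Phi eps h Z) ->
  minimizer h m Z1 -> minimizer h m Z2 -> proj (h *m Z1^R) = proj (h *m Z2^R).
Proof.
move=> hu m0 hm Z1m Z2m.
rewrite -[RHS](minimizer_nested hu m0 hm Z2m Z1m) // -[LHS]tr_proj.
by rewrite -{1}(minimizer_nested hu m0 hm Z1m Z2m) // trmx_mul !tr_proj.
Qed.

Lemma expmx_mul (x y : 'rV[R]_n) : expmx x *m expmx y = expmx (x + y).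
Proof.
by rewrite mul_diag_mx; apply/matrixP => i j; rewrite !mxE mulrnAr expRD.
Qed.

Lemma det_expmx (x : 'rV[R]_n) : \det (expmx x) = expR (\sum_p x 0 p).
Proof. by rewrite det_diag expR_sum; apply: eq_bigr => p _; rewrite mxE. Qed.

Lemma expmx_unit (x : 'rV[R]_n) : expmx x \in unitmx.
Proof. by rewrite unitmxE unitfE det_expmx gt_eqF ?expR_gt0. Qed.

Lemma extremal_expmx h m (x : 'rV[R]_n) : \sum_p x 0 p = 0 ->
  (forall k (Z : 'M[int]_(n, k)), gram Z != 0 -> m <= Phi eps (expmx x *m h) Z) ->
  extremal h m -> extremal (expmx x *m h) m.
Proof.
move=> x0 xm [hu hd _ hx]; split => //.
- by rewrite unitmx_mul expmx_unit.
- by rewrite det_mulmx det_expmx x0 expR0 mul1r.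
move=> y y0 e e0; have [|k [Z ZP]] := hx (y + x) _ e e0.
  by under eq_bigr => p _ do rewrite mxE; rewrite big_split /= y0 x0 addr0.
by exists k, Z; rewrite mulmxA expmx_mul.
Qed.

(** One [t] serves infinitely many [Z]: each Gram determinant shrinks at most by a factor depending
    only on [t], [x] and [n], which the gap [e] absorbs. *)
Lemma small_move h m e (x : 'rV[R]_n) : h \in unitmx -> 0 < m -> 0 < e ->
  (forall k (Z : 'M[int]_(n, k)), gram Z != 0 -> Phi eps h Z != m -> m + e <= Phi eps h Z) ->
  exists2 t, 0 < t & forall k (Z : 'M[int]_(n, k)), gram Z != 0 -> Phi eps h Z != m ->
    m + e / 2 <= Phi eps (expmx (t *: x) *m h) Z.
Proof.
move=> hu m0 e0 he; pose X := \sum_p `|x 0 p|.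
have X0 : 0 <= X by exact: sumr_ge0.
(* With [t = e / D] this gives [(m + e) * (1 - 2 * n%:R * t * X) >= m + e / 2]; the summand 1 keeps
   [D] positive when [X = 0]. *)
pose D := 2 * (m + e) * (2 * n%:R * X + 1).
have nX : 0 <= 2 * n%:R * X by rewrite !mulr_ge0.
have nX1 : 0 < 2 * n%:R * X + 1 by rewrite ltr_wpDl.
have D0 : 0 < D by rewrite !mulr_gt0 // addr_gt0.
exists (e / D) => [|k Z Z0 Zm]; first by rewrite divr_gt0.
set t := e / D; have t0 : 0 < t by rewrite divr_gt0.
have Dt : D * t = e by rewrite mulrC divfK // gt_eqF.
have gr0 : gram (h *m Z^R) != 0 by rewrite gram_unit_mul // gram_intr_neq0.
have lb : gram (h *m Z^R) * expR (- (2 * n%:R * (t * X))) <= gram (expmx (t *: x) *m (h *m Z^R)).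
  have xt (p : 'I_n) : - (t * X) <= (t *: x) 0 p.
    rewrite mxE -mulrN ler_pM2l // lerNl (le_trans (ler_norm _)) // normrN.
    by rewrite /X (bigD1 p) //= lerDl sumr_ge0.
  apply: le_trans (gram_exp_lb gr0 xt).
  rewrite ler_wpM2l ?gram_ge0 // ler_expR lerN2 ler_wpM2r ?(mulr_ge0 (ltW t0)) //.
  by rewrite ler_wpM2l // ler_nat (free_leq Z0).
rewrite /Phi -mulmxA; apply: le_trans (ler_wpM2r (ltW (rank_wt_gt0 _ _ _)) lb).
rewrite mulrAC; apply: le_trans (ler_wpM2r (expR_ge0 _) (he _ _ Z0 Zm)).
apply: le_trans (ler_wpM2l _ (expR_ge1Dx _)); last by rewrite addr_ge0 // ltW.
move: Dt; rewrite /D; move: (n%:R : R) X0 nX => N X0 nX Dt.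
have : 0 <= t * (m + e) by rewrite mulr_ge0 ?ltW ?addr_gt0.
nra.
Qed.

Lemma Phi_top h k (Z : 'M[int]_(n, k)) : \det h ^+ 2 = 1 -> gram Z != 0 -> k = n -> 1 <= Phi eps h Z.
Proof.
move=> hd Z0 kn; subst k; rewrite /Phi /rank_wt subrr !mulr0 expR0 mulr1 gram_mulmx.
rewrite /gram !det_mulmx !det_tr det_map_mx -[X in _ * X]expr2 hd mulr1 -rmorphXn /=.
rewrite (ler_int R 1) -gtz0_ge1 exprn_even_gt0 //=.
by move: Z0; rewrite /gram det_mulmx mulf_eq0 negb_or => /andP[].
Qed.

Lemma Phi_bot h k (Z : 'M[int]_(n, k)) : k = 0%N -> Phi eps h Z = 1.
Proof.
by move=> k0; subst k; rewrite /Phi /rank_wt mul0r mulr0 expR0 mulr1 /gram det_mx00.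
Qed.

(** The index [i] stands for rank [i.+1]; rank 0 has value 1 and cannot be minimizing when
    [m < 1]. *)
Definition min_ranks h m : {set 'I_n} :=
  [set i : 'I_n | `[< exists Z : 'M[int]_(n, i.+1), minimizer h m Z >]]%SET.

Lemma tdiag1 (x : 'rV[R]_n) : tdiag x 1%:M = \sum_p x 0 p.
Proof. by apply: eq_bigr => p _; rewrite mxE eqxx mulr1. Qed.

Lemma tdiagZ (t : R) (x : 'rV[R]_n) P : tdiag (t *: x) P = t * tdiag x P.
Proof. by rewrite mulr_sumr; apply: eq_bigr => p _; rewrite mxE mulrA. Qed.

Lemma extremal_descent h m : (0 < n)%N -> 0 < m < 1 -> extremal h m ->
  exists2 h', extremal h' m & (#|min_ranks h' m| < #|min_ranks h m|)%N.
Proof.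
move=> n0 /andP[m0 m1] hext; have [hu hd hm hx] := hext.
have [e e0 gap] := Phi_gap eps m hu.
have {}gap k (Z : 'M[int]_(n, k)) : gram Z != 0 -> Phi eps h Z != m -> m + e <= Phi eps h Z.
  by move=> Z0; apply: contraNle => /(gap _ _ Z0) Zm; rewrite eq_le Zm hm.
(* The second alternative adds the full rank, so that the identity is among the projections and
   orthogonality to it means trace zero. *)
pose Q (i : 'I_n) (Z : 'M[int]_(n, i.+1)) := gram Z != 0 /\ (Phi eps h Z = m \/ i.+1 = n).
pose A : {set 'I_n} := [set i : 'I_n | `[< exists Z, Q i Z >]]%SET.
pose Zc (i : 'I_n) : 'M[int]_(n, i.+1) := xget 0 [set Z | Q i Z].
have ZcQ i : i \in A -> Q i (Zc i).
  by rewrite inE => /asboolP[Z ZQ]; exact: (xgetPex 0 (ex_intro _ Z ZQ)).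
pose r (j : 'I_#|A|) := (enum_val j).+1.
pose P (j : 'I_#|A|) := proj (h *m (Zc (enum_val j))^R).
have PQ (j : 'I_#|A|) : Q _ (Zc (enum_val j)) := ZcQ _ (enum_valP j).
have P0 (j : 'I_#|A|) : gram (h *m (Zc (enum_val j))^R) != 0.
  by rewrite gram_unit_mul // gram_intr_neq0; have [] := PQ j.
have rn j : (0 < r j <= n)%N by rewrite /r ltn_ord.
have Pn j : r j = n -> P j = 1%:M by move=> rj; exact: (proj_full (P0 j) rj).
have Pmin (j : 'I_#|A|) : r j <> n -> minimizer h m (Zc (enum_val j)).
  by move=> rjn; have [Z0 [Zm|]] := PQ j.
have Ptr j : (P j)^T = P j by exact: tr_proj.
have nest i j : (r i <= r j)%N -> P i *m P j = P i /\ P j *m P i = P i.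
  move=> ij; have E : P j *m P i = P i.
    have [/Pn ->|jn] := eqVneq (r j) n; first by rewrite mul1mx.
    have in_ : r i <> n by move: jn (rn j) ij => /eqP; lia.
    exact: (minimizer_nested hu m0 hm (Pmin _ in_) (Pmin _ (elimN eqP jn)) ij).
  by split=> //; rewrite -[RHS]Ptr -[in RHS]E trmx_mul !Ptr.
have Pmem k (Z : 'M[int]_(n, k)) : minimizer h m Z ->
    exists j, [/\ r j = k, r j <> n & P j = proj (h *m Z^R)].
  case: k Z => [Z [_ Zm]|k Z Zm].
    by move: m1; rewrite -Zm Phi_bot // ltxx.
  have kn : k.+1 <> n.
    by move=> kn; case: Zm => Z0 Zm; move: m1; rewrite -Zm ltNge (Phi_top hd Z0 kn).
  have kn' : (k < n)%N by apply: free_leq Zm.1.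
  have iA : Ordinal kn' \in A.
    by rewrite inE; apply/asboolP; exists Z; split; [exact: Zm.1|left; exact: Zm.2].
  exists (enum_rank_in iA (Ordinal kn')); rewrite /r /P enum_rankK_in //; split => //.
  apply: (minimizer_proj hu m0 hm) => //.
  by have [Z0 [|//]] := ZcQ _ iA; split.
have [j0 rj0] : exists j, r j = n.
  have kn : (n.-1 < n)%N by rewrite prednK.
  have iA : Ordinal kn \in A.
    rewrite inE; apply/asboolP => /=.
    have ex1 k : k = n -> exists Z : 'M[int]_(n, k), gram Z != 0.
      by move=> ->; exists 1%:M; rewrite /gram trmx1 mulmx1 det1 oner_eq0.
    have [Z Z0] := ex1 n.-1.+1 (prednK n0).
    by exists Z; split=> //; right; rewrite /= prednK.
  by exists (enum_rank_in iA (Ordinal kn)); rewrite /r enum_rankK_in //= prednK.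
have ex_small x := small_move x hu m0 e0 gap.
have [PW|PW] := pselect (forall x : 'rV[R]_n, (forall i, tdiag x (P i) = 0) ->
    forall i, comm_mx (diag_mx x) (P i)).
  have Pid j : P j *m P j = P j by exact: proj_idem (P0 j).
  have Pc i j : comm_mx (P i) (P j).
    rewrite /comm_mx; have [ij|/ltnW ji] := leqP (r i) (r j).
      by have [-> ->] := nest _ _ ij.
    by have [-> ->] := nest _ _ ji.
  have Pfree : forall a : 'rV_#|A|, \sum_i a 0 i *: P i = 0 -> a = 0.
    apply: (nested_proj_free (r := r)) => //; last by move=> j; exact: mxtrace_proj.
    by move=> i j [] /val_inj/enum_val_inj.
  (* Value 1 is prescribed at the minimizing ranks, and 0 at the identity to keep trace zero. *)
  have [x Hx] := diag_dual Pid Pc Pfree PW (\row_j (r j != n)%:R).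
  have x0 : \sum_p x 0 p = 0 by rewrite -tdiag1 -(Pn _ rj0) Hx mxE rj0 eqxx.
  have [t t0 Ht] := ex_small x.
  have tx0 : \sum_p (t *: x) 0 p = 0 by rewrite -tdiag1 tdiagZ tdiag1 x0 mulr0.
  (* Non-minimizers stay above [m + e / 2], and minimizers gain at least [2 * t * m] because
     [1 + 2 * t <= expR (2 * t)]; both contradict extremality. *)
  have e'0 : 0 < Num.min (e / 2) (m * (2 * t)) by rewrite lt_min divr_gt0 // !mulr_gt0.
  have [k [Z [Z0]]] := hx _ tx0 _ e'0.
  rewrite -ltrBlDl lt_min => /andP[]; rewrite !ltrBlDl ltNge.
  have [Zm _|Zm] := eqVneq (Phi eps h Z) m; last by rewrite Ht.
  have [j [_ jn Pj]] := Pmem _ _ (conj Z0 Zm).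
  rewrite ltNge => /negP[]; rewrite /Phi -mulmxA.
  have gr0 : gram (h *m Z^R) != 0 by rewrite gram_unit_mul // gram_intr_neq0.
  apply: le_trans (ler_wpM2r (ltW (rank_wt_gt0 _ _ _)) (gram_exp_ge (t *: x) gr0)).
  rewrite mulrAC -/(Phi eps h Z) Zm tdiagZ -Pj Hx mxE; move/eqP: jn => ->; rewrite mulr1.
  by rewrite -{1}[m]mulr1 -mulrDr ler_wpM2l ?expR_ge1Dx // ltW.
(* Here [x] is neutral to first order for all projections, but fails to commute with one, where
   Jensen is strict and the minimizers of that rank disappear. *)
have [x [xP [j jx]]] : exists x, (forall i, tdiag x (P i) = 0) /\
    exists j, ~ comm_mx (diag_mx x) (P j).
  apply: contrapT => H; apply: PW => x xP i; apply: contrapT => xi.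
  by apply: H; exists x; split=> //; exists i.
have x0 : \sum_p x 0 p = 0 by rewrite -tdiag1 -(Pn _ rj0) xP.
have [t t0 Ht] := ex_small x.
have tx0 : \sum_p (t *: x) 0 p = 0 by rewrite -tdiag1 tdiagZ tdiag1 x0 mulr0.
have Pge k (Z : 'M[int]_(n, k)) : minimizer h m Z -> m <= Phi eps (expmx (t *: x) *m h) Z.
  move=> Zm; have [i [_ _ Pi]] := Pmem _ _ Zm; case: Zm => Z0 Zm.
  have gr0 : gram (h *m Z^R) != 0 by rewrite gram_unit_mul // gram_intr_neq0.
  rewrite /Phi -mulmxA -{1}Zm ler_wpM2r ?(ltW (rank_wt_gt0 _ _ _)) //.
  have := gram_exp_ge (t *: x) gr0.
  by rewrite tdiagZ -Pi xP !mulr0 expR0 mulr1.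
have me : m < m + e / 2 by rewrite ltrDl divr_gt0.
have h'ge k (Z : 'M[int]_(n, k)) : gram Z != 0 -> m <= Phi eps (expmx (t *: x) *m h) Z.
  move=> Z0; have [Zm|Zm] := eqVneq (Phi eps h Z) m; first exact: Pge (conj Z0 Zm).
  by apply: le_trans (Ht _ _ Z0 Zm); exact: ltW.
exists (expmx (t *: x) *m h); first exact: extremal_expmx.
(* Non-minimizers remain strictly above [m], so the move creates no minimizer. *)
have old k (Z : 'M[int]_(n, k)) : minimizer (expmx (t *: x) *m h) m Z -> minimizer h m Z.
  move=> [Z0 Zm]; split => //; apply/eqP; apply: contraT => /(Ht _ _ Z0).
  by rewrite Zm leNgt me.
apply: proper_card; apply/properP; split.
  by apply/fintype.subsetP => i; rewrite !inE => -[Z /old Zm]; exists Z.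
have jn : r j <> n.
  by move=> /Pn Pj1; apply: jx; rewrite Pj1 /comm_mx mulmx1 mul1mx.
exists (enum_val j); rewrite inE; first by apply/asboolP; exists (Zc (enum_val j)); exact: Pmin.
apply/asboolP => -[Z Zm']; have Zm := old _ _ Zm'.
have gr0 : gram (h *m Z^R) != 0 by rewrite gram_unit_mul // gram_intr_neq0; case: Zm.
have PZ : P j = proj (h *m Z^R) := minimizer_proj hu m0 hm (Pmin _ jn) Zm.
have [_ Zm2] := Zm'; have [_ Zm1] := Zm; move: Zm2.
rewrite /Phi -mulmxA => Zm2.
have := gram_exp_gt (x := t *: x) gr0; rewrite -PZ tdiagZ xP !mulr0 expR0 mulr1.
move=> H; have : gram (h *m Z^R) < gram (expmx (t *: x) *m (h *m Z^R)).
  apply: H => txc; apply: jx; rewrite /comm_mx.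
  have : t *: (diag_mx x *m P j) = t *: (P j *m diag_mx x).
    by rewrite scalemxAl scalemxAr -linearZ.
  by move/(scalerI (lt0r_neq0 t0)).
by rewrite -(ltr_pM2r (rank_wt_gt0 n eps (enum_val j).+1)) Zm2 -/(Phi eps h Z) Zm1 ltxx.
Qed.

Lemma not_extremal h m : (0 < n)%N -> 0 < m < 1 -> ~ extremal h m.
Proof.
move=> n0 m01; have [N] := ubnP #|min_ranks h m|; elim: N h => // N IH h hN hext.
have [h' h'ext h'lt] := extremal_descent n0 m01 hext.
exact: (IH h' (leq_trans h'lt hN)).
Qed.

End Local.

(** * Reduction of quadratic forms *)

Section Reduction.
Variable R : realType.

Definition qf (n : nat) (S : 'M[R]_n) (z : 'cV[int]_n) : R := ((z^R)^T *m S *m z^R) 0 0.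

Lemma qf_mul (n m : nat) (S : 'M[R]_n) (V : 'M[int]_(n, m)) (z : 'cV[int]_m) :
  qf ((V^R)^T *m S *m V^R) z = qf S (V *m z).
Proof. by rewrite /qf intr_mxM trmx_mul !mulmxA. Qed.

Lemma qf_col (n m : nat) (S : 'M[R]_n) (V : 'M[int]_(n, m)) i :
  ((V^R)^T *m S *m V^R) i i = qf S (col i V).
Proof.
rewrite /qf -[col i V]/(col i V) colE intr_mxM map_delta_mx trmx_mul trmx_delta.
by rewrite -!mulmxA -rowE !mulmxA -colE !mxE; apply: eq_bigr => k _; rewrite !mxE.
Qed.

Lemma qfZ (n : nat) (S : 'M[R]_n) (m : int) (z : 'cV[int]_n) :
  qf S (m *: z) = m%:~R ^+ 2 * qf S z.
Proof.
by rewrite /qf map_mxZ /= [(_ *: _)^T]linearZ /= -!scalemxAl -scalemxAr scalerA [LHS]mxE -expr2.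
Qed.

Lemma nearest_int (x : R) : exists t : int, `|t%:~R + x| <= 1 / 2.
Proof.
exists (- Num.floor (x + 1 / 2)); have := floor_itv (x + 1 / 2).
rewrite rmorphN /= intrD => /andP[]; set f := (Num.floor _)%:~R => f1 f2.
by rewrite ler_norml; apply/andP; split; lra.
Qed.

Definition schur (n : nat) (S : 'M[R]_(1 + n)) : 'M[R]_n :=
  drsubmx S - (S 0 0)^-1 *: (dlsubmx S *m ursubmx S).

Lemma ulsubmx_scalar (n : nat) (S : 'M[R]_(1 + n)) : ulsubmx S = (S 0 0)%:M.
Proof. by rewrite [LHS]mx11_scalar !mxE lshift0. Qed.

Lemma det_schur (n : nat) (S : 'M[R]_(1 + n)) : S 0 0 != 0 ->
  \det S = S 0 0 * \det (schur S).
Proof.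
move=> a0; have {1}-> : S = block_mx (S 0 0)%:M 0 (dlsubmx S) (schur S) *m
    block_mx 1%:M ((S 0 0)^-1 *: ursubmx S) 0 1%:M.
  rewrite mulmx_block !mulmx0 !mulmx1 !addr0 -[LHS]submxK ulsubmx_scalar.
  rewrite mul_scalar_mx scalerA mulfV // scale1r; congr block_mx.
  by rewrite /schur -scalemxAr addrC subrK.
by rewrite det_mulmx det_lblock det_ublock !det1 det_scalar1 !mulr1.
Qed.

Lemma qf_schur (n : nat) (S : 'M[R]_(1 + n)) (t : int) (z : 'cV[int]_n) :
  S^T = S -> S 0 0 != 0 ->
  qf S (col_mx t%:M z) =
   S 0 0 * (t%:~R + (ursubmx S *m z^R) 0 0 / S 0 0) ^+ 2 + qf (schur S) z.
Proof.
move=> Ssym a0; rewrite /qf map_col_mx tr_col_mx.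
have dlE : dlsubmx S = (ursubmx S)^T by rewrite trmx_ursub Ssym.
rewrite -{1}[S]submxK mul_row_block mul_row_col ulsubmx_scalar dlE.
have -> : (t%:M)^R = (t%:~R : R)%:M :> 'M_1 by rewrite map_scalar_mx.
rewrite tr_scalar_mx mul_scalar_mx /schur.
set u := ursubmx S; set w := z^R; set a := S 0 0.
have uw : (u *m w) = ((u *m w) 0 0)%:M by rewrite -mx11_scalar.
rewrite mulmxBr mulmxBl !mulmxDl -!scalemxAr -!scalemxAl mul_scalar_mx.
have wu : w^T *m u^T = ((u *m w) 0 0)%:M by rewrite -trmx_mul {1}uw tr_scalar_mx.
rewrite dlE -/u !mulmxA wu !mul_scalar_mx -!scalemxAl.
move: (w^T *m _ *m w) (u *m w) => Q s.
by rewrite !mxE eqxx !mulr1n; field.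
Qed.

(* Hermite's induction: take a vector [z] whose value is at most 3/2 times the infimum; completing
   a divisor of [z] to a basis, the Schur complement is still bounded below, with bounded determinant. *)
Lemma reduction (n : nat) (d C : R) : 0 < d -> exists B, forall S : 'M[R]_n,
  S^T = S -> (forall z, z != 0 -> d <= qf S z) -> \det S <= C ->
  exists2 U : 'M[int]_n, U \in unitmx & forall i, ((U^R)^T *m S *m U^R) i i <= B.
Proof.
elim: n d C => [|n IH] d C d0.
  by exists 0 => S _ _ _; exists 1%:M; [exact: unitmx1|case].
(* With corner entry [a >= d], the Schur complement will be at least [a / 3] on nonzero vectors and
   have determinant [\det S / a]. *)
have [|B' HB'] := IH (d / 3) (`|C| / d); first by rewrite divr_gt0.
exists (`|C| + 4 * `|B'|) => S Ssym Sd SC.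
pose E := [set qf S z | z in [set z : 'cV[int]_n.+1 | z != 0]].
have E0 : E !=set0.
  exists (qf S (delta_mx 0 0)); exists (delta_mx 0 0) => //=.
  by apply/eqP => /matrixP/(_ 0 0); rewrite !mxE.
have Elb : lbound E d by move=> _ [z zn0 <-]; exact: Sd.
have mu_d : d <= inf E by exact: lb_le_inf.
have mu0 : 0 < inf E by exact: lt_le_trans mu_d.
have [|_ [z /= zn0 <-] zmu] := @inf_adherent _ E (inf E / 2) _ (conj E0 (ex_intro _ d Elb)).
  by rewrite divr_gt0.
have muE w : w != 0 -> inf E <= qf S w.
  by move=> wn0; apply: ge_inf; [exists d|exists w].
have z0 : gram z != 0.
  by apply/negP; rewrite /gram det_mx11 => /eqP zz; case/eqP: zn0; apply: trmul_eq0;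
     apply/matrixP => i j; rewrite !ord1 zz mxE.
have [a [c [I [Y [nac NI NY ker [[V IYV] IY0]]]]]] := adapted_basis (annih z).
have [M zM] := ker _ _ (annih_mul z).
have [W zI] := annih_ker NI.
have Iinj (x : 'cV_a) : I *m x = 0 -> x = 0.
  move=> Ix; have /gram_kerP/(_ (col_mx x 0)) := IY0.
  rewrite mul_row_col Ix mulmx0 addr0 => /(_ erefl)/(congr1 usubmx).
  by rewrite col_mxKu linear0.
have a1 : a = 1%N.
  apply/eqP; rewrite eqn_leq; apply/andP; split.
    apply: (@free_leq _ _ W); apply/gram_kerP => x Wx; apply: Iinj; apply/eqP.
    have : gram z *: (I *m x) = 0 by rewrite scalemxAl zI -mulmxA Wx mulmx0.
    by move/eqP; rewrite scalemx_eq0 (negbTE z0).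
  rewrite lt0n; apply/eqP => a0; case/eqP: zn0; move: I M zM {NI ker IYV IY0 zI Iinj W}.
  by rewrite a0 => I M ->; rewrite [I]thinmx0 mul0mx.
subst a; have cn : c = n by case: nac.
subst c; clear nac.
pose U0 : 'M[int]_(1 + n) := row_mx I Y.
have U0u : U0 \in unitmx by have [] := mulmx1_unit IYV.
have qI : qf S I <= 3 / 2 * inf E.
  have zE : z = M 0 0 *: I by rewrite zM [M]mx11_scalar mul_mx_scalar !mxE.
  have Mn0 : M 0 0 != 0 by apply: contraNneq zn0 => M0; rewrite zE M0 scale0r.
  apply: le_trans (ltW (lt_le_trans zmu _)); last by lra.
  rewrite zE qfZ ler_peMl //.
    apply: le_trans (muE I _); first exact: ltW.
    by apply: contraNneq zn0 => I0; rewrite zE I0 scaler0.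
  by rewrite -rmorphXn /= (ler_int R 1) -gtz0_ge1 exprn_even_gt0.
pose S1 : 'M[R]_(1 + n) := (U0^R)^T *m S *m U0^R.
have S1sym : S1^T = S1 by rewrite /S1 !trmx_mul trmxK Ssym mulmxA.
have S1q (w : 'cV_(1 + n)) : qf S1 w = qf S (U0 *m w) by exact: qf_mul.
have S1mu (w : 'cV_(1 + n)) : w != 0 -> inf E <= qf S1 w.
  rewrite S1q => wn0; apply: muE; apply: contraNneq wn0 => /(congr1 (mulmx (invmx U0))).
  by rewrite mulKmx // mulmx0 => ->.
have a_qf : S1 0 0 = qf S I.
  rewrite /S1 qf_col; congr qf; apply/matrixP => i j; rewrite !mxE ord1.
  by case: splitP => // k _; rewrite ord1.
set a := S1 0 0 in a_qf.
have a_mu : a <= 3 / 2 * inf E by rewrite a_qf.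
have a_ge : inf E <= a.
  by rewrite a_qf; apply: muE; apply/eqP => I0; have := Iinj 1%:M; rewrite I0 mul0mx => /(_ erefl)/matrixP/(_ 0 0); rewrite !mxE.
have a0 : 0 < a by exact: lt_le_trans a_ge.
have detS1 : \det S1 = \det S.
  rewrite /S1 !det_mulmx det_tr det_map_mx mulrAC -expr2 -rmorphXn /=.
  by move: U0u; rewrite unitmxE => /pred2P[] ->; rewrite ?sqrrN expr1n mul1r.
(* Rounding the first coordinate makes the square term at most [a / 4], while [inf E >= 2 * a / 3];
   this leaves [5 * a / 12]. *)
have SchM w : w != 0 -> a / 3 <= qf (schur S1) w.
  move=> wn0; have [t Ht] := nearest_int ((ursubmx S1 *m w^R) 0 0 / a).
  have := S1mu (col_mx t%:M w); rewrite qf_schur ?gt_eqF // -/a => /(_ _).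
  have -> : col_mx t%:M w != 0 by rewrite col_mx_eq0 negb_and wn0 orbT.
  move=> /(_ isT); move: Ht; rewrite ler_norml; set s := _ + _ => /andP[s1 s2] H.
  have : s ^+ 2 <= 1 / 4 by nra.
  nra.
have sch_sym : (schur S1)^T = schur S1.
  by rewrite /schur linearB linearZ /= trmx_mul trmx_drsub trmx_ursub trmx_dlsub S1sym.
have sch_d w : w != 0 -> d / 3 <= qf (schur S1) w.
  move=> wn0; apply: le_trans (SchM _ wn0).
  by rewrite ler_wpM2r ?invr_ge0 // (le_trans mu_d).
have sch_det : \det (schur S1) <= `|C| / d.
  have -> : \det (schur S1) = \det S / a.
    by rewrite -detS1 det_schur ?gt_eqF // mulrAC mulfV ?mul1r ?gt_eqF.
  apply: (@le_trans _ _ (`|C| / a)).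
    by rewrite ler_wpM2r ?invr_ge0 ?(ltW a0) // (le_trans SC) // ler_norm.
  by rewrite ler_wpM2l // lef_pV2 ?posrE // (le_trans mu_d).
have [U' U'u U'B] := HB' _ sch_sym sch_d sch_det.
(* A diagonal entry of the reduced Schur complement is a value at a nonzero vector, so
   [a / 3 <= B']; if the complement is empty, [a] is the determinant. *)
have a_le : a <= `|C| + 3 * `|B'|.
  have := detS1; rewrite det_schur ?gt_eqF // -/a; move: SchM U'u U'B.
  move: (schur S1) U' => S'' U' SM Uu UB detE.
  have [n0|n0] := posnP n; last first.
    pose j := Ordinal n0; have Uj : col j U' != 0.
      apply: contraTneq Uu => Uj; apply/negP => Uu.
      have := congr1 (mulmx (invmx U')) Uj; rewrite colE mulKmx // mulmx0.
      by move/matrixP/(_ j 0); rewrite !mxE !eqxx.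
    have := SM _ Uj; have := UB j; rewrite qf_col => h1 h2.
    have := ler_norm B'; have := normr_ge0 C; lra.
  have : a <= C.
    move: SC; rewrite -detE; move: S'' {detE SM Uu UB}; rewrite n0 => S''.
    by rewrite det_mx00 mulr1.
  have := ler_norm C; have := normr_ge0 B'; lra.
(* Size reduction: shifting the later basis vectors by multiples of the first leaves an excess of at
   most [a / 4] over the Schur diagonal. *)
have [t Ht] : exists t : 'rV[int]_n, forall j, `|(t 0 j)%:~R + (ursubmx S1 *m U'^R) 0 j / a| <= 1 / 2.
  have /choice[f Hf] := fun j => nearest_int ((ursubmx S1 *m U'^R) 0 j / a).
  by exists (\row_j f j) => j; rewrite mxE.
pose U1 : 'M[int]_(1 + n) := block_mx 1%:M t 0 U'.
have U1u : U1 \in unitmx by rewrite unitmxE det_ublock det1 mul1r -unitmxE.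
exists (U0 *m U1); first by rewrite unitmx_mul U0u.
move=> i; rewrite qf_col colE -mulmxA -colE -S1q.
case: (splitP (i : 'I_(1 + n))) => j ij.
  have -> : col i U1 = col_mx 1%:M 0.
    have -> : i = lshift n 0 :> 'I_(1 + n) by apply: val_inj; rewrite /= ij ord1.
    apply/matrixP => p q; rewrite !ord1 [LHS]mxE -(splitK p).
    case: (fintype.split p) => p' /=; rewrite ?(col_mxEu, col_mxEd).
      exact: (@row_mxEl _ 1 1 n 1%:M t p' 0).
    exact: (@row_mxEl _ n 1 n 0 U' p' 0).
  rewrite qf_schur ?gt_eqF // -/a /qf map_mx0 !mulmx0 !mxE mul0r addr0 !addr0 expr1n mulr1.
  by apply: le_trans a_le _; rewrite lerD2l ler_wpM2r // ler_nat.
have -> : col i U1 = col_mx (t 0 j)%:M (col j U').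
  have -> : i = rshift 1 j :> 'I_(1 + n) by apply: val_inj; rewrite /= ij.
  apply/matrixP => p q; rewrite !ord1 [LHS]mxE -(splitK p).
  case: (fintype.split p) => p' /=; rewrite ?(col_mxEu, col_mxEd).
    by rewrite [LHS](@row_mxEr _ 1 1 n 1%:M t p' j) !ord1 !mxE.
  by rewrite [LHS](@row_mxEr _ n 1 n 0 U' p' j) mxE.
rewrite qf_schur ?gt_eqF // -/a.
have -> : (ursubmx S1 *m (col j U')^R) 0 0 = (ursubmx S1 *m U'^R) 0 j.
  by rewrite !mxE; apply: eq_bigr => k _; rewrite !mxE.
have := U'B j; rewrite qf_col => qB; have := Ht j; set s := _ + _; rewrite ler_norml => /andP[s1 s2].
have s3 : s ^+ 2 <= 1 / 4 by nra.
have := ler_norm B'; have := normr_ge0 C; have := normr_ge0 B'; nra.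
Qed.

End Reduction.

(** * Limits of lattices *)

Lemma ultra_fmap (T S : Type) (F : set_system T) (f : T -> S) :
  UltraFilter F -> UltraFilter (f @ F).
Proof.
move=> FU; apply: Build_UltraFilter => G GP FG.
apply/seteqP; split; last exact: FG.
move=> A GA; rewrite /fmap /=.
have [//|FA] := in_ultra_setVsetC (f @^-1` A) FU.
have GnA : G (~` A) by apply: FG.
have G0 : G set0 by rewrite -(setICr A); exact: filterI.
by case: (@filter_not_empty _ G _ G0).
Qed.

Section Limits.
Variables (R : realType) (F : set_system nat).
Hypothesis FU : UltraFilter F.

Local Instance F_proper : ProperFilter F := @ultra_proper _ _ FU.

(** Ultrafilters replace the extraction of subsequences; convergence is compactness of a segment. *)
Lemma ultra_bounded_cvg (u : nat -> R) (B : R) : (forall i, `|u i| <= B) ->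
  exists l : R, u @ F --> l.
Proof.
move=> uB; have := @segment_compact R (- B) B; rewrite compact_ultra.
move=> /(_ (u @ F) (ultra_fmap u FU)) [].
  rewrite /fmap /=; apply: (@filterE _ F) => i; rewrite /= in_itv /= -ler_norml; exact: uB.
by move=> l [_ ul]; exists l.
Qed.

Lemma cvg_fsum (I : finType) (u : I -> nat -> R) (l : I -> R) :
  (forall j, u j i @[i --> F] --> l j) -> \sum_j u j i @[i --> F] --> \sum_j l j.
Proof.
move=> ul; apply: (@cvg_big R I +%R 0 xpredT _ nat F (index_enum I) u l).
- exact: add_continuous.
- by move=> j _; exact: ul.
Qed.

Lemma cvg_fprod (I : finType) (u : I -> nat -> R) (l : I -> R) :
  (forall j, u j i @[i --> F] --> l j) -> \prod_j u j i @[i --> F] --> \prod_j l j.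
Proof.
move=> ul; apply: (@cvg_big R I *%R 1 xpredT _ nat F (index_enum I) u l).
- exact: mul_continuous.
- by move=> j _; exact: ul.
Qed.

Definition mcvg (m n : nat) (H : nat -> 'M[R]_(m, n)) (h : 'M[R]_(m, n)) :=
  forall p q, H i p q @[i --> F] --> h p q.

Lemma mcvg_cst (m n : nat) (h : 'M[R]_(m, n)) : mcvg (fun=> h) h.
Proof. by move=> p q; exact: cvg_cst. Qed.

Lemma mcvg_mul (m n p : nat) (H : nat -> 'M[R]_(m, n)) h (G : nat -> 'M[R]_(n, p)) g :
  mcvg H h -> mcvg G g -> mcvg (fun i => H i *m G i) (h *m g).
Proof.
move=> Hh Gg a b; rewrite mxE; under eq_cvg => i do rewrite mxE.
by apply: cvg_fsum => j; apply: cvgM; [exact: Hh|exact: Gg].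
Qed.

Lemma mcvg_tr (m n : nat) (H : nat -> 'M[R]_(m, n)) h :
  mcvg H h -> mcvg (fun i => (H i)^T) h^T.
Proof. by move=> Hh a b; rewrite mxE; under eq_cvg => i do rewrite mxE; exact: Hh. Qed.

Lemma mcvg_sub (m n k l : nat) (f : 'I_k -> 'I_m) (g : 'I_l -> 'I_n) (H : nat -> 'M[R]_(m, n)) h :
  mcvg H h -> mcvg (fun i => mxsub f g (H i)) (mxsub f g h).
Proof. by move=> Hh a b; rewrite mxE; under eq_cvg => i do rewrite mxE; exact: Hh. Qed.

Lemma cvg_det (n : nat) (H : nat -> 'M[R]_n) h :
  mcvg H h -> \det (H i) @[i --> F] --> \det h.
Proof.
move=> Hh; apply: cvg_fsum => s; apply: cvgM; first exact: cvg_cst.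
by apply: cvg_fprod => j; exact: Hh.
Qed.

Lemma cvg_gram (n k : nat) (H : nat -> 'M[R]_(n, k)) h :
  mcvg H h -> gram (H i) @[i --> F] --> gram h.
Proof. by move=> Hh; apply: cvg_det; apply: mcvg_mul => //; exact: mcvg_tr. Qed.

Lemma mcvg_bounded (m n : nat) (H : nat -> 'M[R]_(m, n)) (B : R) :
  (forall i p q, `|H i p q| <= B) -> exists h, mcvg H h.
Proof.
move=> HB.
have /choice[f Hf] : forall pq : 'I_m * 'I_n, exists l : R, H i pq.1 pq.2 @[i --> F] --> l.
  by move=> [p q]; apply: (@ultra_bounded_cvg _ B) => i; exact: HB.
by exists (\matrix_(p, q) f (p, q)) => p q; rewrite mxE; exact: (Hf (p, q)).
Qed.

End Limits.

(** * Gram determinants under matrices close to the identity *)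

Section Distortion.
Variables (R : realType) (n : nat).

Definition plucker_form (k : nat) (g g' : {ffun 'I_k -> 'I_n}) (T : 'M[R]_n) : R :=
  (k`!%:R)^-1 ^+ 2 * \sum_(f : {ffun 'I_k -> 'I_n})
    \det (colsub g (rowsub f T)) * \det (colsub g' (rowsub f T)).

Lemma gram_plucker_form (k : nat) (T : 'M[R]_n) (B : 'M[R]_(n, k)) :
  gram (T *m B) = (k`!%:R)^-1 * \sum_g \sum_g' plucker_form g g' T *
    (\det (rowsub g B) * \det (rowsub g' B)).
Proof.
rewrite gramE; congr (_ * _).
transitivity (\sum_(f : {ffun 'I_k -> 'I_n}) \sum_(g : {ffun 'I_k -> 'I_n}) \sum_(g' : {ffun 'I_k -> 'I_n})
   (k`!%:R)^-1 ^+ 2 * (\det (colsub g (rowsub f T)) * \det (colsub g' (rowsub f T))) *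
    (\det (rowsub g B) * \det (rowsub g' B))).
  apply: eq_bigr => f _; rewrite det_rowsub_mul exprMn [X in _ * X]expr2 big_distrlr mulr_sumr.
  apply: eq_bigr => g _; rewrite mulr_sumr; apply: eq_bigr => g' _ /=; ring.
rewrite exchange_big; apply: eq_bigr => g _; rewrite exchange_big; apply: eq_bigr => g' _ /=.
by rewrite /plucker_form [in RHS]mulr_sumr [RHS]mulr_suml.
Qed.

Definition distort (k : nat) (T : 'M[R]_n) : R :=
  \sum_(g : {ffun 'I_k -> 'I_n}) \sum_(g' : {ffun 'I_k -> 'I_n}) `|plucker_form g g' T - plucker_form g g' 1%:M|.

(** Products of two minors of [B] are at most a constant times [gram B], so comparing coefficients
    gives a relative error uniform in [B]. *)
Lemma gram_distort (k : nat) (T : 'M[R]_n) (B : 'M[R]_(n, k)) :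
  `|gram (T *m B) - gram B| <= distort k T * gram B.
Proof.
have gB : gram B = gram (1%:M *m B) by rewrite mul1mx.
have pB (g : {ffun 'I_k -> 'I_n}) : \det (rowsub g B) ^+ 2 <= k`!%:R * gram B.
  by rewrite mulr_natl gram_sum (bigD1 g) //= lerDl sumr_ge0 // => g' _; exact: sqr_ge0.
rewrite {1}gB !gram_plucker_form -mulrBr -sumrB normrM ger0_norm ?invr_ge0 ?ler0n //.
rewrite mulrC ler_pdivrMr ?ltr0n ?fact_gt0 // -mulrA [_ * k`!%:R]mulrC.
apply: le_trans (ler_norm_sum _ _ _) _; rewrite /distort mulr_suml ler_sum // => g _.
rewrite -sumrB; apply: le_trans (ler_norm_sum _ _ _) _; rewrite mulr_suml ler_sum // => g' _.
rewrite -mulrBl normrM ler_wpM2l //.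
have := pB g; have := pB g'; set a := \det _; set b := \det _ => a2 b2.
rewrite ler_norml; apply/andP; split; nra.
Qed.

Variables (F : set_system nat).
Hypothesis FU : UltraFilter F.
Local Existing Instance F_proper.

Lemma cvg_distort (k : nat) (T : nat -> 'M[R]_n) :
  mcvg F T 1%:M -> distort k (T i) @[i --> F] --> 0.
Proof.
move=> T1.
have -> : 0 = \sum_(g : {ffun 'I_k -> 'I_n}) \sum_(g' : {ffun 'I_k -> 'I_n})
    `|plucker_form g g' 1%:M - plucker_form g g' 1%:M| :> R.
  by rewrite big1 // => g _; rewrite big1 // => g' _; rewrite subrr normr0.
apply: (cvg_fsum FU) => g; apply: (cvg_fsum FU) => g'.
apply: cvg_norm; apply: cvgB; last exact: cvg_cst.
apply: cvgM; first exact: cvg_cst.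
apply: (cvg_fsum FU) => f; have fT := mcvg_sub (f := f) (g := id) T1.
by apply: cvgM; apply: (cvg_det FU); [exact: (mcvg_sub (f := id) (g := g) fT)|exact: (mcvg_sub (f := id) (g := g') fT)].
Qed.

(** Uniformity over all [B] is what allows infima over all subgroups to be compared; the distortions
    of all ranks up to [n] are summed to get a single event. *)
Lemma gram_near (T : nat -> 'M[R]_n) (e : R) : mcvg F T 1%:M -> 0 < e ->
  \forall i \near F, forall k (B : 'M[R]_(n, k)), (1 - e) * gram B <= gram (T i *m B).
Proof.
move=> T1 e0.
have := @cvg_fsum R F FU 'I_n.+1 (fun k i => distort k (T i)) (fun=> 0) (fun k => cvg_distort k T1).
rewrite big1 // => D0; move: D0 => /cvgr_lt/(_ _ e0); apply: filterS => i De k B.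
have [kn|nk] := leqP k n; last first.
  have -> : gram B = 0; last by rewrite mulr0 gram_ge0.
  by apply/eqP; apply: contraTT nk => /gram_neq0_leq; rewrite -leqNgt.
have : distort k (T i) <= e.
  apply: le_trans (ltW De); rewrite (bigD1 (Ordinal (kn : (k < n.+1)%N))) //= lerDl.
  by rewrite !sumr_ge0 // => l _; rewrite !sumr_ge0 // => g _; rewrite sumr_ge0.
have := gram_distort (T i) B; rewrite ler_norml => /andP[h1 _] h2.
have := ler_wpM2r (gram_ge0 B) h2; lra.
Qed.

End Distortion.

Lemma gram_col_neq0 (R : realDomainType) (n : nat) (z : 'cV[R]_n) : z != 0 -> gram z != 0.
Proof.
apply: contra_neq => /eqP; rewrite /gram det_mx11 => /eqP zz; apply: trmul_eq0.
by apply/matrixP => i j; rewrite !ord1 zz mxE.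
Qed.

Lemma gram_unitM (n k : nat) (U : 'M[int]_n) (Z : 'M[int]_(n, k)) :
  \det U = 1 -> gram Z != 0 -> gram (U *m Z) != 0.
Proof.
move=> U1 /gram_kerP Zi; apply/gram_kerP => x; rewrite -mulmxA => /(congr1 (mulmx (invmx U))).
by rewrite mulKmx ?unitmxE ?U1 ?unitr1 // mulmx0 => /Zi.
Qed.

Section Limits.
Variables (R : realType) (n : nat).

(** Reduction is applied to [h^T *m h], whose diagonal in the new basis consists of squared column
    lengths; flipping one column repairs the sign of the determinant. *)
Lemma bounded_basis (d : R) : 0 < d -> exists B : R, forall h : 'M[R]_n, \det h = 1 ->
  (forall z : 'cV[int]_n, z != 0 -> d <= gram (h *m z^R)) ->
  exists2 U : 'M[int]_n, \det U = 1 & forall p q, `|(h *m U^R) p q| <= B.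
Proof.
move=> d0; have [B HB] := reduction n 1 d0.
exists (1 + `|B|) => h hd hz.
have Ssym : (h^T *m h)^T = h^T *m h by rewrite trmx_mul trmxK.
have Sdet : \det (h^T *m h) <= 1 by rewrite det_mulmx det_tr hd mulr1.
have Sd z : z != 0 -> d <= qf (h^T *m h) z.
  by move=> /hz; rewrite /gram det_mx11 /qf trmx_mul !mulmxA.
have [U Uu UB] := HB _ Ssym Sd Sdet.
have hU p q : `|(h *m U^R) p q| <= 1 + `|B|.
  have := UB q; rewrite -!mulmxA mulmxA -trmx_mul mxE (bigD1 p) //= => s.
  have : (h *m U^R) p q ^+ 2 <= B.
    apply: le_trans s; rewrite expr2 [X in X * _ + _]mxE lerDl sumr_ge0 // => k _.
    by rewrite [X in X * _]mxE -expr2 sqr_ge0.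
  set x := _ p q => xB; have := ler_norm B; rewrite -real_normK ?num_real // in xB.
  by move: xB; move: `|x| `|B| (normr_ge0 x) (normr_ge0 B) => y b; nra.
have U2 : \det U = 1 \/ \det U = -1 by move: Uu; rewrite unitmxE => /pred2P.
have [U1|U1] := U2; first by exists U.
have [n0|n0] := posnP n.
  by exists U => //; move: U U1 {Uu UB hU U2}; rewrite n0 => U; rewrite det_mx00.
pose sg : 'rV[int]_n := \row_j (if j == Ordinal n0 then -1 else 1).
exists (U *m diag_mx sg).
  rewrite det_mulmx U1 det_diag (bigD1 (Ordinal n0)) //= big1 => [|j /negbTE jn].
    by rewrite mxE eqxx.
  by rewrite mxE jn.
move=> p q; rewrite intr_mxM mulmxA map_diag_mx mul_mx_diag mxE normrM.
suff -> : `|(map_mx intr sg) 0 q : R| = 1 by rewrite mulr1.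
by rewrite !mxE; case: ifP => _; rewrite ?rmorphN /= ?normrN normr1.
Qed.

Variables (F : set_system nat).
Hypothesis FU : UltraFilter F.
Local Existing Instance F_proper.

(** Mahler's compactness criterion, in terms of bases. *)
Lemma limit_lattice (d : R) (H : nat -> 'M[R]_n) : 0 < d -> (forall i, \det (H i) = 1) ->
  (forall i (z : 'cV[int]_n), z != 0 -> d <= gram (H i *m z^R)) ->
  exists U h, [/\ forall i, \det (U i) = 1 :> int, \det h = 1 &
    mcvg F (fun i => H i *m (U i)^R) h].
Proof.
move=> d0 Hd Hz; have [B HB] := bounded_basis d0.
have /choice[U HU] : forall i, exists U : 'M[int]_n,
    \det U = 1 /\ forall p q, `|(H i *m U^R) p q| <= B.
  by move=> i; have [U U1 UB] := HB _ (Hd i) (Hz i); exists U.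
have [h Hh] := mcvg_bounded FU (fun i => (HU i).2).
exists U, h; split => //; first by move=> i; have [] := HU i.
have := cvg_det FU Hh.
have -> : (fun i => \det (H i *m (U i)^R)) = (fun=> 1).
  by apply/funext => i; rewrite det_mulmx det_map_mx (HU i).1 Hd mulr1.
by move=> /cvg_lim <- //; rewrite lim_cst.
Qed.

(** * Existence of a maximizer in the orbit closure *)

Section Approx.
Variables (eps : R) (g0 : 'M[R]_n).
Hypotheses (eps0 : 0 < eps) (n0 : (0 < n)%N) (g01 : \det g0 = 1).
Hypothesis ooF : \oo `<=` F.

Let E (x : 'rV[R]_n) := [set r : R | exists k (Z : 'M[int]_(n, k)),
  gram Z != 0 /\ r = Phi eps (expmx x *m g0) Z].
Let S := [set inf (E x) | x in [set x : 'rV[R]_n | \sum_p x 0 p = 0]].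

Let g0u : g0 \in unitmx. Proof. by rewrite unitmxE g01 unitr1. Qed.

Let xgu x : expmx x *m g0 \in unitmx. Proof. by rewrite unitmx_mul expmx_unit. Qed.

Let E1 x : E x 1.
Proof.
exists 0%N, 0; rewrite Phi_bot //; split => //.
by rewrite /gram det_mx00 oner_eq0.
Qed.

Let E0 x : lbound (E x) 0.
Proof. by move=> _ [k [Z [Z0 ->]]]; rewrite ltW // Phi_gt0. Qed.

Let infE x k (Z : 'M[int]_(n, k)) : gram Z != 0 -> inf (E x) <= Phi eps (expmx x *m g0) Z.
Proof. by move=> Z0; apply: ge_inf; [exists 0|exists k, Z]. Qed.

Let S_sup : has_sup S.
Proof.
split; first by exists (inf (E 0)); exists 0 => //=; rewrite big1 // => p _; rewrite mxE.
by exists 1 => _ [x _ <-]; apply: ge_inf => //; exists 0.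
Qed.

Let supS (x : 'rV[R]_n) : \sum_p x 0 p = 0 -> inf (E x) <= sup S.
Proof. by move=> x0; apply: ub_le_sup; [case: S_sup|exists x]. Qed.

Let sup_gt0 : 0 < sup S.
Proof.
have [e e0 He] := Phi_gap eps 0 (xgu 0).
apply: lt_le_trans e0 _; apply: le_trans (supS (x := 0) _); last first.
  by rewrite big1 // => p _; rewrite mxE.
apply: lb_le_inf; first by exists 1.
move=> _ [k [Z [Z0 ->]]]; rewrite leNgt; apply/negP => Ze.
have := He k Z Z0; rewrite add0r => /(_ Ze).
by rewrite leNgt Phi_gt0.
Qed.

Let Phi_sub (h : 'M[R]_n) (U : 'M[int]_n) k (Z : 'M[int]_(n, k)) :
  Phi eps (h *m U^R) Z = Phi eps h (U *m Z).
Proof. by rewrite /Phi intr_mxM mulmxA. Qed.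

(** For a limit of near-maximizers, the lower bound passes to the limit for each [Z] separately; the
    last clause of [extremal] needs [gram_near]. *)
Let exists_extremal : exists h : 'M[R]_n, extremal eps h (sup S).
Proof.
set ms := sup S.
(* The bound [ms / 2] excludes short vectors uniformly, for compactness; the second bound gives [ms]
   in the limit. *)
have /choice[x Hx] (i : nat) : exists x : 'rV[R]_n, \sum_p x 0 p = 0 /\
    (ms / 2 <= inf (E x) /\ ms - i.+1%:R^-1 <= inf (E x)).
  have e0 : 0 < Num.min (ms / 2) (i.+1%:R^-1) by rewrite lt_min divr_gt0 //= invr_gt0.
  have [_ [x x0 <-] xS] := sup_adherent e0 S_sup; exists x; split => //.
  move: xS; rewrite -/ms ltrBlDr -ltrBlDl lt_min => /andP[].
  clear e0; by move: (inf _) (i.+1%:R^-1) ms => u v w h1 h2; split; lra.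
pose H i := expmx (x i) *m g0.
have Hd i : \det (H i) = 1 by rewrite /H det_mulmx det_expmx (Hx i).1 expR0 mul1r.
have d0 : 0 < ms / 2 / rank_wt n eps 1 by rewrite !divr_gt0 ?rank_wt_gt0.
have Hz i (z : 'cV[int]_n) : z != 0 -> ms / 2 / rank_wt n eps 1 <= gram (H i *m z^R).
  move=> zn0; rewrite ler_pdivrMr ?rank_wt_gt0 //.
  by apply: le_trans (infE _ (gram_col_neq0 zn0)); exact: (Hx i).2.1.
have [U [h [U1 h1 Hh]]] := limit_lattice d0 Hd Hz.
have hu : h \in unitmx by rewrite unitmxE h1 unitr1.
exists h; split => //; first by rewrite h1 expr1n.
  move=> k Z Z0.
  have cvPhi : Phi eps (H i *m (U i)^R) Z @[i --> F] --> Phi eps h Z.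
    apply: cvgM; last exact: cvg_cst.
    by apply: (cvg_gram FU); apply: (mcvg_mul FU) => //; exact: mcvg_cst.
  have cvms : ms - i.+1%:R^-1 @[i --> F] --> ms - 0.
    apply: cvgB; first exact: cvg_cst.
    by apply: cvg_trans (@cvg_harmonic R); exact: cvg_app.
  rewrite subr0 in cvms; apply: (ler_cvg_to cvms cvPhi); apply: filterE => i.
  by rewrite Phi_sub; apply: le_trans (infE _ (gram_unitM (U1 i) Z0)); exact: (Hx i).2.2.
move=> y y0 e e0; apply: contrapT => noZ.
have hy k (Z : 'M[int]_(n, k)) : gram Z != 0 -> ms + e <= Phi eps (expmx y *m h) Z.
  by move=> Z0; rewrite leNgt; apply/negP => Zlt; apply: noZ; exists k, Z.
(* [T i] carries [expmx y *m h] to a basis of a lattice in the orbit of [g0]. As [T i] tends to 1,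
   an infimum of at least [ms + e] would yield an orbit lattice with infimum above the supremum. *)
pose T i := expmx y *m (H i *m (U i)^R) *m invmx (expmx y *m h).
have T1 : mcvg F T 1%:M.
  have -> : 1%:M = expmx y *m h *m invmx (expmx y *m h).
    by rewrite mulmxV // unitmx_mul expmx_unit.
  apply: (mcvg_mul FU); last exact: mcvg_cst.
  by apply: (mcvg_mul FU) => //; exact: mcvg_cst.
have mse : 0 < ms + e by rewrite addr_gt0 ?sup_gt0.
(* Chosen so that [(1 - e / (2 * (ms + e))) * (ms + e) = ms + e / 2]. *)
have e'0 : 0 < e / (2 * (ms + e)) by rewrite divr_gt0 // mulr_gt0.
have [i Hi] := filter_ex (gram_near FU T1 e'0).
have yx0 : \sum_p (y + x i) 0 p = 0.
  by under eq_bigr => p _ do rewrite mxE; rewrite big_split /= y0 (Hx i).1 addr0.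
have := supS yx0; rewrite leNgt => /negP; apply.
apply: (@lt_le_trans _ _ (ms + e / 2)); first by rewrite ltrDl divr_gt0.
apply: lb_le_inf; first by exists 1.
move=> _ [k [Z [Z0 ->]]].
have Uu : U i \in unitmx by rewrite unitmxE (U1 i) unitr1.
have Vd : \det (invmx (U i)) = 1 by rewrite det_inv (U1 i) invr1.
have := hy _ _ (gram_unitM Vd Z0); set Z' := invmx (U i) *m Z => hZ.
have -> : Phi eps (expmx (y + x i) *m g0) Z = Phi eps (T i *m (expmx y *m h)) Z'.
  rewrite /T mulmxKV; last by rewrite unitmx_mul expmx_unit.
  by rewrite mulmxA Phi_sub /Z' mulKVmx // /H mulmxA expmx_mul.
rewrite /Phi -mulmxA; apply: le_trans (ler_wpM2r (ltW (rank_wt_gt0 _ _ _)) (Hi _ _)).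
rewrite -mulrA -/(Phi eps (expmx y *m h) Z').
have e'1 : e / (2 * (ms + e)) <= 1.
  by rewrite ler_pdivrMr ?mulr_gt0 // mul1r; have := sup_gt0; rewrite -/ms; lra.
apply: (@le_trans _ _ ((1 - e / (2 * (ms + e))) * (ms + e))).
  by rewrite le_eqVlt; apply/orP; left; apply/eqP; field; rewrite gt_eqF.
by rewrite ler_wpM2l // subr_ge0.
Qed.

(** Otherwise the supremum over the orbit is below 1 and its maximizer contradicts
    [not_extremal]. *)
Lemma approx_Phi (m : R) : m < 1 -> exists2 x : 'rV[R]_n, \sum_p x 0 p = 0 &
  forall k (Z : 'M[int]_(n, k)), gram Z != 0 -> m <= Phi eps (expmx x *m g0) Z.
Proof.
move=> m1; apply: contrapT => nox.
have [h hext] := exists_extremal.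
apply: (not_extremal eps0 n0 _ hext); rewrite sup_gt0 /=.
apply: le_lt_trans m1; apply: sup_le_ub; first by case: S_sup.
move=> _ [x x0 <-]; rewrite leNgt; apply/negP => mx; apply: nox; exists x => // k Z Z0.
by apply: le_trans (ltW mx) _; exact: infE.
Qed.

End Approx.

End Limits.

(** * Stable lattices in the orbit closure *)

Lemma gram_rank (R : realFieldType) (n k : nat) (B : 'M[R]_(n, k)) : gram B != 0 -> \rank B = k.
Proof.
move=> B0; have : B^T *m B \in unitmx by rewrite unitmxE unitfE.
rewrite -row_full_unit => /eqP rk; apply/eqP; rewrite eqn_leq rank_leq_col /=.
by rewrite -{1}rk mxrankM_maxr.
Qed.

Lemma stable_gram (R : realType) (n : nat) (h : 'M[R]_n) : h \in unitmx ->
  (forall k (Z : 'M[int]_(n, k)), gram Z != 0 -> 1 <= gram (h *m Z^R)) -> stable (Zspan h).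
Proof.
move=> hu hZ L [L0 LB] Lh _.
have [||k [Z [Z0 ZL]]] := @subgroup_basis n [set z | L (h *m z^R)].
- by move: L0; rewrite inE /= => L0; rewrite map_mx0 mulmx0.
- move=> x y /= Lx Ly; rewrite map_mxB mulmxBr.
  by have := LB (h *m x^R) (h *m y^R); rewrite !inE; apply.
have -> : L = Zspan (h *m Z^R).
  apply/seteqP; split=> [v Lv|_ [w _ <-]].
    have [z _ zv] := Lh v Lv; have /ZL[w zw] : L (h *m z^R) by rewrite zv.
    by exists w => //; rewrite -mulmxA -intr_mxM -zw.
  by rewrite -mulmxA -intr_mxM; apply: (ZL _).2; exists w.
rewrite covolE; last by rewrite gram_rank // gram_unit_mul // gram_intr_neq0.
by rewrite -[leLHS]sqrtr1 ler_wsqrtr // hZ.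
Qed.

Lemma prodN_le (R : realType) (n : nat) (v : 'cV[R]_n) : (0 < n)%N ->
  `|prodN v| <= (enorm v / Num.sqrt n%:R) ^+ n.
Proof.
move=> n0; have nR : 0 < n%:R :> R by rewrite ltr0n.
rewrite -(@ler_pXn2r _ 2) // ?nnegrE ?exprn_ge0 ?divr_ge0 ?sqrtr_ge0 //.
have s0 : 0 <= \sum_(j < n) v j 0 ^+ 2 by rewrite sumr_ge0 // => i _; exact: sqr_ge0.
rewrite real_normK ?num_real // exprAC expr_div_n (sqr_sqrtr (ltW nR)) (sqr_sqrtr s0).
rewrite /prodN -prodrXl.
have := (@leif_AGM R 'I_n predT (fun j => v j 0 ^+ 2) (fun i _ => sqr_ge0 _)).1.
by rewrite cardT size_enum_ord.
Qed.

Section Final.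
Variables (R : realType) (n : nat) (F : set_system nat).
Hypotheses (n0 : (0 < n)%N) (FU : UltraFilter F) (ooF : \oo `<=` F).
Local Existing Instance F_proper.

Lemma approx_stable (g0 : 'M[R]_n) (e : R) : \det g0 = 1 -> 0 < e < 1 ->
  exists2 x : 'rV[R]_n, \sum_p x 0 p = 0 &
    forall k (Z : 'M[int]_(n, k)), gram Z != 0 -> 1 - e <= gram (expmx x *m g0 *m Z^R).
Proof.
move=> g01 /andP[e0 e1]; have nR : 0 < n%:R :> R by rewrite ltr0n.
(* Since [k * (n - k) <= n ^ 2], the weight is at most [expR (e / 2)], and
   [(1 - e / 2) ^+ 2 >= 1 - e]. *)
pose eps := e / (2 * n%:R ^+ 2).
have eps0 : 0 < eps by rewrite divr_gt0 // mulr_gt0 // exprn_gt0.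
have m1 : 1 - e / 2 < 1 by lra.
have [x x0 Hx] := approx_Phi FU eps0 n0 g01 ooF m1.
exists x => // k Z Z0; have := Hx k Z Z0; rewrite /Phi.
have kn : k%:R <= n%:R :> R by rewrite ler_nat (free_leq Z0).
have k0 : 0 <= k%:R :> R by rewrite ler0n.
have wle : rank_wt n eps k <= expR (e / 2).
  rewrite ler_expR; have -> : e / 2 = eps * n%:R ^+ 2 by rewrite /eps; field; rewrite gt_eqF.
  rewrite ler_pM2l //; nra.
have : 1 - e / 2 <= expR (- (e / 2)) by exact: expR_ge1Dx.
rewrite expRN; move: wle; have := rank_wt_gt0 n eps k; have := expR_gt0 (e / 2).
move: (expR _) (rank_wt _ _ _) (gram_ge0 (expmx x *m g0 *m Z^R)); move: (gram _) => G E w G0 E0 w0 wE H1 H2.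
have : (1 - e / 2) * E <= 1.
  by apply: le_trans (ler_wpM2r (ltW E0) H1) _; rewrite mulVf ?gt_eqF.
have : 1 - e / 2 <= G * E by apply: le_trans H2 _; rewrite ler_wpM2l.
move=> H3 H4.
have H5 : (1 - e / 2) * (1 - e / 2) <= (1 - e / 2) * (G * E) by rewrite ler_wpM2l //; lra.
have H6 : G * ((1 - e / 2) * E) <= G * 1 by rewrite ler_wpM2l.
nra.
Qed.

Lemma stable_limit (g0 : 'M[R]_n) : \det g0 = 1 ->
  exists (x : nat -> 'rV[R]_n) (U : nat -> 'M[int]_n) h,
  [/\ forall i, \sum_p x i 0 p = 0, forall i, \det (U i) = 1, \det h = 1,
    mcvg F (fun i => expmx (x i) *m g0 *m (U i)^R) h & stable (Zspan h)].
Proof.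
move=> g01.
(* The shift to [i.+2] keeps the tolerance at most 1/2, so that vector lengths are bounded below for
   compactness. *)
have /choice[x Hx] (i : nat) : exists x : 'rV[R]_n, \sum_p x 0 p = 0 /\
    forall k (Z : 'M[int]_(n, k)), gram Z != 0 -> 1 - i.+2%:R^-1 <= gram (expmx x *m g0 *m Z^R).
  have [|x x0 xZ] := @approx_stable g0 (i.+2%:R^-1) g01; last by exists x.
  by rewrite invr_gt0 ltr0n /= invf_lt1 ?ltr0n // ltr1n.
have Hd i : \det (expmx (x i) *m g0) = 1 by rewrite det_mulmx det_expmx (Hx i).1 expR0 mul1r.
have Hz i (z : 'cV[int]_n) : z != 0 -> 1 / 2 <= gram (expmx (x i) *m g0 *m z^R).
  move=> zn0; apply: le_trans ((Hx i).2 _ _ (gram_col_neq0 zn0)).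
  have : i.+2%:R^-1 <= 2^-1 :> R by rewrite lef_pV2 ?posrE ?ltr0n // ler_nat.
  by move: (i.+2%:R^-1) => q; lra.
have [|U [h [U1 h1 Hh]]] := limit_lattice FU _ Hd Hz; first by rewrite divr_gt0.
exists x, U, h; split => //; first by move=> i; exact: (Hx i).1.
apply: stable_gram; first by rewrite unitmxE h1 unitr1.
move=> k Z Z0.
have cvg1 : gram (expmx (x i) *m g0 *m (U i)^R *m Z^R) @[i --> F] --> gram (h *m Z^R).
  by apply: (cvg_gram FU); apply: (mcvg_mul FU) => //; exact: mcvg_cst.
have cvg2 : (1 : R) - i.+1%:R^-1 @[i --> F] --> (1 : R) - 0.
  by apply: cvgB; [exact: cvg_cst|apply: cvg_trans (@cvg_harmonic R); exact: cvg_app].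
rewrite subr0 in cvg2; apply: (ler_cvg_to cvg2 cvg1); apply: filterE => i.
rewrite -mulmxA -intr_mxM; apply: le_trans ((Hx i).2 _ _ (gram_unitM (U1 i) Z0)).
by rewrite lerD2l lerN2 lef_pV2 ?posrE ?ltr0n // ler_nat.
Qed.

Lemma pow_near (c e : R) : 0 < e -> exists2 d, 0 < d & (c + d) ^+ n <= c ^+ n + e.
Proof.
move=> e0.
have cv : \prod_(j < n) (c + i.+1%:R^-1) @[i --> F] --> \prod_(j < n) (c + 0 : R).
  apply: (cvg_fprod FU) => j; apply: cvgD; first exact: cvg_cst.
  by apply: cvg_trans (@cvg_harmonic R); exact: cvg_app.
have /cvgr_lt/(_ (c ^+ n + e)) := cv.
rewrite prodr_const card_ord addr0 ltrDl => /(_ e0)/filter_ex[i].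
rewrite prodr_const card_ord => /ltW H; exists (i.+1%:R^-1).
  by rewrite invr_gt0 ltr0n.
exact: H.
Qed.

End Final.

(** * Transfer of the covering bound from the stable limit to the original lattice *)

Lemma prodN_expmx (R : realType) (n : nat) (x : 'rV[R]_n) (v : 'cV[R]_n) :
  \sum_p x 0 p = 0 -> prodN (expmx x *m v) = prodN v.
Proof.
move=> x0; rewrite -[RHS]mul1r -expR0 -x0 expR_sum -big_split /=.
by apply: eq_bigr => p _; rewrite mul_diag_mx !mxE.
Qed.

Theorem corollary5p1 (R : realType) (n : nat) (hn : (2 <= n)%N) :
  (forall x : set 'cV[R]_n, unimodular_lattice x -> stable x ->
     (covrad x <= (Num.sqrt n%:R / 2)%:E)%E) ->
  minkowski_conjecture R n.
Proof.
move=> Hst _ [g0 /= g01 <-].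
have n0 : (0 < n)%N by exact: ltnW.
have sn0 : 0 < Num.sqrt n%:R :> R by rewrite sqrtr_gt0 ltr0n.
have [F [FU ooF]] : exists F : set_system nat, UltraFilter F /\ \oo `<=` F.
  by apply: ultraFilterLemma.
have FP : ProperFilter F by exact: ultra_proper.
apply: ge_ereal_sup => _ [u _ <-]; apply/lee_addgt0Pr => e e0.
have [x [U [h [x0 U1 h1 Hh sth]]]] := stable_limit n0 FU ooF g01.
have [d d0 Hd] : exists2 d, 0 < d & (1 / 2 + d) ^+ n <= (1 / 2) ^+ n + e / 2 :> R.
  by apply: (pow_near n FU ooF); rewrite divr_gt0.
pose H i := expmx (x i) *m g0 *m (U i)^R.
have Hu i : H i \in unitmx.
  by rewrite unitmxE !det_mulmx det_expmx x0 expR0 g01 det_map_mx U1 !mul1r unitr1.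
(* Coordinates of the moved point in the basis [H i]; their fractional parts are bounded, so the
   point converges modulo the moving lattices. *)
pose s i := invmx (H i) *m (expmx (x i) *m u).
pose fl i : 'cV[int]_n := \col_j Num.floor (s i j 0).
pose fr i := s i - (fl i)^R.
have [fro Hfr] : exists fro, mcvg F fr fro.
  apply: (mcvg_bounded FU (B := 1)) => i p q.
  have -> : fr i p q = s i p 0 - (Num.floor (s i p 0))%:~R.
    by rewrite ord1 [LHS]mxE [X in _ + X]mxE [X in - X]mxE [fl i _ _]mxE.
  have /andP[] := floor_itv (s i p 0); rewrite intrD mulr1z ler_norml.
  by move: (s i p 0) => b h1a h2; apply/andP; split; lra.
pose w := h *m fro.
(* The slack makes the inequality strict, so the infimum yields an actual lattice vector near
   [w]. *)
have : (ereal_inf [set (enorm (w - v))%:E | v in Zspan h] < (Num.sqrt n%:R / 2 + d * Num.sqrt n%:R)%:E)%E.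
  apply: (@le_lt_trans _ _ (Num.sqrt n%:R / 2)%:E); last by rewrite lte_fin ltrDl mulr_gt0.
  apply: le_trans (Hst (Zspan h) _ sth); last by exists h.
  by apply: ereal_sup_ubound; exists w.
move=> /ereal_inf_lt[_ [_ [z _ <-] <-]]; rewrite lte_fin => wz.
have Nwz : `|prodN (w - h *m z^R)| <= (1 / 2) ^+ n + e / 2.
  apply: le_trans Hd; apply: le_trans (prodN_le _ n0) _.
  rewrite lerXn2r ?nnegrE ?divr_ge0 ?sqrtr_ge0 //; first by rewrite addr_ge0 // ?ltW // divr_gt0.
  by rewrite ler_pdivrMr // (le_trans (ltW wz)) //; lra.
(* By continuity the bound at the limit holds up to [e / 2] at some [i]; there [expmx (x i)] can be
   undone, as it preserves [prodN]. *)
have cvN : `|prodN (H i *m (fr i - z^R))| @[i --> F] --> `|prodN (w - h *m z^R)|.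
  have frz : mcvg F (fun i => fr i - z^R) (fro - z^R).
    move=> p q; rewrite mxE; under eq_cvg => i do rewrite mxE.
    by apply: cvgD; [exact: Hfr|exact: cvg_cst].
  rewrite -mulmxBr; apply: cvg_norm; have HM := mcvg_mul FU Hh frz.
  exact: (cvg_fprod FU (fun j => HM j 0)).
have : `|prodN (w - h *m z^R)| < (1 / 2) ^+ n + e by apply: le_lt_trans Nwz _; rewrite ltrD2l; lra.
move/(cvgr_lt _ cvN)/filter_ex => [i Ni].
apply: ge_ereal_inf.
exists `|prodN (u - g0 *m (U i *m (fl i + z))^R)|%:E.
  by exists (g0 *m (U i *m (fl i + z))^R) => //; exists (U i *m (fl i + z)).
have half : 1 / 2 ^+ n = (1 / 2) ^+ n :> R by rewrite expr_div_n expr1n.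
rewrite -EFinD lee_fin half.
apply: le_trans (ltW Ni); rewrite le_eqVlt; apply/orP; left; apply/eqP; congr `|_|.
rewrite -(prodN_expmx _ (x0 i)); congr prodN.
rewrite /fr -addrA -opprD -map_mxD [RHS]mulmxBr mulKVmx // mulmxBr.
by rewrite intr_mxM !mulmxA.
Qed.
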